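(* Let $f_0$ be a nonvanishing particular solution of the Schrödinger equation $$(-\Delta+u)f=0,$$ and let $\mathbf{F}$ be the general solution of the equation $$(D+M^{\mathbf{h}})\mathbf{F}=0,\qquad\text{where } \mathbf{h}=\frac{Df_0}{f_0}.$$ Then the general solution $f$ of $(-\Delta+u)f=0$ is the logarithmic antiderivative of $\mathbf{q}$: $$\frac{Df}{f}=\mathbf{q},$$ where $\mathbf{q}=\mathbf{h}+\mathbf{g}$, $\mathbf{g}=\frac{D\Psi}{\Psi}$ and $\Psi$ is obtained from the equation $$\operatorname{grad}\Psi=\frac{\mathbf{F}}{f_0}.$$
   Context: $\mathbb{H}(\mathbb{C})$ is the algebra of complex quaternions (biquaternions) $q=q_0+q_1\mathbf{i}+q_2\mathbf{j}+q_3\mathbf{k}$, where $q_k\in\mathbb{C}$ and $\mathbf{i},\mathbf{j},\mathbf{k}$ are the quaternionic imaginary units. Biquaternions with $q_0=0$ are called purely vectorial and are identified with vectors of $\mathbb{C}^3$; bold letters $\mathbf{F},\mathbf{h},\mathbf{q},\mathbf{g}$ denote purely vectorial biquaternion valued functions. $M^{p}$ is the operator of multiplication by a biquaternion $p$ from the right: $M^{p}q=q\cdot p$. For a differentiable biquaternion valued function $q$ of $\mathbf{x}=(x_1,x_2,x_3)$, $Dq=\mathbf{i}\frac{\partial q}{\partial x_1}+\mathbf{j}\frac{\partial q}{\partial x_2}+\mathbf{k}\frac{\partial q}{\partial x_3}$; for a scalar function $q_0$, $Dq_0=\operatorname{grad}q_0$, and $Dq_0/q_0$ is called the logarithmic derivative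 of $q_0$. $\Delta=\frac{\partial^2}{\partial x_1^2}+\frac{\partial^2}{\partial x_2^2}+\frac{\partial^2}{\partial x_3^2}$. The functions $u$ and $f$ are complex valued, and $f$ is assumed twice differentiable. $\Psi$ is a scalar function. *)

(* Defs.v *)
From HB Require Import structures.
From mathcomp Require Import all_boot all_order all_algebra.
From mathcomp Require Import all_classical all_reals all_analysis.
From mathcomp Require Import complex.
From mathcomp Require Import ring.
Set Implicit Arguments.
Unset Strict Implicit.
Unset Printing Implicit Defensive.
Import Order.TTheory GRing.Theory Num.Theory.
Import numFieldNormedType.Exports.
Local Open Scope classical_set_scope.
Local Open Scope complex_scope.
Local Open Scope ring_scope.

Definition biquat (R : realType) : Type := 'rV[R[i]]_4.

Section BiquatAlgebra.
Variable R : realType.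
Local Notation C := R[i].

HB.instance Definition _ := GRing.Lmodule.copy (biquat R) 'rV[R[i]]_4.

Definition bq_coord (q : biquat R) (k : 'I_4) : C := (q : 'rV_4) 0 k.

Definition mk_biquat (a b c d : C) : biquat R :=
  \row_(k < 4) [:: a; b; c; d]`_k.

Definition bq_one : biquat R := mk_biquat 1 0 0 0.

(* Hamilton's product: i^2 = j^2 = k^2 = ijk = -1, with i, j, k commuting with
   the scalars of R[i] (in particular with its imaginary unit). *)
Definition bq_mul (p q : biquat R) : biquat R :=
  let p0 := bq_coord p 0 in let p1 := bq_coord p 1 in
  let p2 := bq_coord p 2%:R in let p3 := bq_coord p 3%:R in
  let q0 := bq_coord q 0 in let q1 := bq_coord q 1 in
  let q2 := bq_coord q 2%:R in let q3 := bq_coord q 3%:R in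
  mk_biquat (p0 * q0 - p1 * q1 - p2 * q2 - p3 * q3)
            (p0 * q1 + p1 * q0 + p2 * q3 - p3 * q2)
            (p0 * q2 - p1 * q3 + p2 * q0 + p3 * q1)
            (p0 * q3 + p1 * q2 - p2 * q1 + p3 * q0).

Lemma bq_ext (p q : biquat R) : bq_coord p 0 = bq_coord q 0 ->
  bq_coord p 1 = bq_coord q 1 -> bq_coord p 2%:R = bq_coord q 2%:R ->
  bq_coord p 3%:R = bq_coord q 3%:R -> p = q.
Proof.
move=> e0 e1 e2 e3; apply/rowP => k.
have: k \in [:: 0; 1; 2%:R; 3%:R] by case: k => -[|[|[|[|//]]]] ?.
by rewrite !inE => /or4P[] /eqP ->.
Qed.

Lemma bq_coord_mk a b c d : [/\ bq_coord (mk_biquat a b c d) 0 = a,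
  bq_coord (mk_biquat a b c d) 1 = b, bq_coord (mk_biquat a b c d) 2%:R = c &
  bq_coord (mk_biquat a b c d) 3%:R = d].
Proof. by split; rewrite /bq_coord mxE. Qed.

Lemma bq_coord_mk0 a b c d : bq_coord (mk_biquat a b c d) 0 = a.
Proof. by case: (bq_coord_mk a b c d). Qed.
Lemma bq_coord_mk1 a b c d : bq_coord (mk_biquat a b c d) 1 = b.
Proof. by case: (bq_coord_mk a b c d). Qed.
Lemma bq_coord_mk2 a b c d : bq_coord (mk_biquat a b c d) 2%:R = c.
Proof. by case: (bq_coord_mk a b c d). Qed.
Lemma bq_coord_mk3 a b c d : bq_coord (mk_biquat a b c d) 3%:R = d.
Proof. by case: (bq_coord_mk a b c d). Qed.

Lemma bq_coordD p q k : bq_coord (p + q) k = bq_coord p k + bq_coord q k.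
Proof. by rewrite /bq_coord mxE. Qed.

Lemma bq_coordZ a q k : bq_coord (a *: q) k = a * bq_coord q k.
Proof. by rewrite /bq_coord mxE. Qed.

Definition bq_coordE := (bq_coordD, bq_coordZ,
  bq_coord_mk0, bq_coord_mk1, bq_coord_mk2, bq_coord_mk3).

Lemma bq_mulA : associative bq_mul.
Proof. by move=> p q r; apply: bq_ext; rewrite /bq_mul /= !bq_coordE; ring. Qed.

Lemma bq_mul1 : left_id bq_one bq_mul.
Proof.
by move=> p; apply: bq_ext; rewrite /bq_mul /bq_one /= !bq_coordE; ring.
Qed.

Lemma bq_mulr1 : right_id bq_one bq_mul.
Proof.
by move=> p; apply: bq_ext; rewrite /bq_mul /bq_one /= !bq_coordE; ring.
Qed.

Lemma bq_mulDl : left_distributive bq_mul +%R.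
Proof. by move=> p q r; apply: bq_ext; rewrite /bq_mul /= !bq_coordE; ring. Qed.

Lemma bq_mulDr : right_distributive bq_mul +%R.
Proof. by move=> p q r; apply: bq_ext; rewrite /bq_mul /= !bq_coordE; ring. Qed.

Lemma bq_one_neq0 : bq_one != 0.
Proof.
apply/eqP => /(congr1 (fun q => bq_coord q 0)).
rewrite bq_coord_mk0 /bq_coord mxE => /eqP; apply/negP; exact: oner_neq0.
Qed.

HB.instance Definition _ := GRing.Zmodule_isNzRing.Build (biquat R)
  bq_mulA bq_mul1 bq_mulr1 bq_mulDl bq_mulDr bq_one_neq0.

Lemma bq1E : (1 : biquat R) = mk_biquat 1 0 0 0.
Proof. by []. Qed.

Lemma bq_scalerAl (a : C) (p q : biquat R) : a *: (p * q) = (a *: p) * q.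
Proof. by apply: bq_ext; rewrite /GRing.mul /= /bq_mul /= !bq_coordE; ring. Qed.

HB.instance Definition _ :=
  GRing.Lmodule_isLalgebra.Build C (biquat R) bq_scalerAl.

Lemma bq_scalerAr (a : C) (p q : biquat R) : a *: (p * q) = p * (a *: q).
Proof. by apply: bq_ext; rewrite /GRing.mul /= /bq_mul /= !bq_coordE; ring. Qed.

HB.instance Definition _ :=
  GRing.Lalgebra_isAlgebra.Build C (biquat R) bq_scalerAr.

Definition bi : biquat R := mk_biquat 0 1 0 0.
Definition bj : biquat R := mk_biquat 0 0 1 0.
Definition bk : biquat R := mk_biquat 0 0 0 1.

Lemma bq_decomp (q : biquat R) :
  q = (bq_coord q 0)%:A + bq_coord q 1 *: bi
      + bq_coord q 2%:R *: bj + bq_coord q 3%:R *: bk.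
Proof.
by apply: bq_ext; rewrite /bi /bj /bk bq1E !bq_coordE; ring.
Qed.

Lemma bq_units : [/\ bi * bi = -1, bj * bj = -1, bk * bk = -1 & bi * bj = bk].
Proof.
have E1 : -1 = mk_biquat (-1) 0 0 0.
  by rewrite -scaleN1r; apply: bq_ext; rewrite bq1E !bq_coordE; ring.
split; rewrite ?E1; apply: bq_ext;
  by rewrite /GRing.mul /= /bq_mul /bi /bj /bk /= !bq_coordE; ring.
Qed.

Definition purely_vectorial (q : biquat R) := bq_coord q 0 = 0.

End BiquatAlgebra.

Section Operators.
Variable R : realType.
Local Notation C := R[i].
Local Notation point := 'rV[R]_3.

(* R[i] is not a normed space over R in the library, so calculus for complex
   valued functions of real variables goes through real and imaginary parts. *)
Definition cdifferentiable (f : point -> C) (x : point) : Prop :=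
  differentiable (fun y => complex.Re (f y) : R) x /\
  differentiable (fun y => complex.Im (f y) : R) x.

Definition partial (k : 'I_3) (f : point -> C) (x : point) : C :=
  'D_(delta_mx 0 k) (fun y => complex.Re (f y) : R) x
  +i* 'D_(delta_mx 0 k) (fun y => complex.Im (f y) : R) x.

Definition twice_differentiable_on (A : set point) (f : point -> C) : Prop :=
  forall x, A x ->
    cdifferentiable f x /\ forall k, cdifferentiable (partial k f) x.

Definition laplacian (f : point -> C) (x : point) : C :=
  \sum_(k < 3) partial k (partial k f) x.

Definition schrodinger_sol (A : set point) (u f : point -> C) : Prop :=
  twice_differentiable_on A f /\
  forall x, A x -> - laplacian f x + u x * f x = 0.

Definition bq_differentiable (q : point -> biquat R) (x : point) : Prop :=
  forall k, cdifferentiable (fun y => bq_coord (q y) k) x.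

Definition bq_partial (k : 'I_3) (q : point -> biquat R) (x : point)
    : biquat R :=
  \row_(j < 4) partial k (fun y => bq_coord (q y) j) x.

Definition Dop (q : point -> biquat R) (x : point) : biquat R :=
  bi R * bq_partial 0 q x + bj R * bq_partial 1 q x
  + bk R * bq_partial 2%:R q x.

Definition Mr (p q : point -> biquat R) (x : point) : biquat R := q x * p x.

Definition scal (f : point -> C) (x : point) : biquat R := (f x)%:A.

Definition grad (f : point -> C) (x : point) : biquat R :=
  partial 0 f x *: bi R + partial 1 f x *: bj R + partial 2%:R f x *: bk R.

Lemma partial_cst k (c : C) x : partial k (cst c) x = 0.
Proof. by rewrite /partial /= !derive_cst. Qed.

Lemma Dop_scal (f : point -> C) x : Dop (scal f) x = grad f x.
Proof.
have E k : bq_partial k (scal f) x = (partial k f x)%:A.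
  apply/rowP => j; rewrite mxE [RHS]mxE [X in _ * X]mxE.
  have Ej y : bq_coord (scal f y) j = f y * [:: 1; 0; 0; 0]`_j.
    by rewrite /bq_coord mxE [X in _ * X]mxE.
  under [fun y => bq_coord _ _]eq_fun do rewrite Ej.
  case: j {Ej} => -[|[|[|[|//]]]] ? /=.
  - by rewrite mulr1; congr partial; apply/funext => y; rewrite mulr1.
  1-3: by rewrite mulr0 -[RHS](partial_cst k 0 x); congr partial;
    apply/funext => y; rewrite mulr0.
by rewrite /Dop !E -!scalerAr !mulr1.
Qed.

Definition log_deriv (f : point -> C) (x : point) : biquat R :=
  (f x)^-1 *: Dop (scal f) x.

(* Nothing is required of f outside A, where it may vanish. *)
Definition log_antiderivative (A : set point) (f : point -> C)
    (q : point -> biquat R) : Prop :=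
  forall x, A x -> [/\ cdifferentiable f x, f x != 0 & log_deriv f x = q x].

Definition first_order_sol (A : set point) (h F : point -> biquat R) : Prop :=
  forall x, A x -> [/\ bq_differentiable F x, purely_vectorial (F x) &
                       Dop F x + Mr h F x = 0].

Definition grad_potential (A : set point) (f0 : point -> C)
    (F : point -> biquat R) (Psi : point -> C) : Prop :=
  forall x, A x -> cdifferentiable Psi x /\ grad Psi x = (f0 x)^-1 *: F x.

(* Connected, and every loop is null-homotopic relative to its base point. *)
Definition simply_connected (A : set point) : Prop :=
  connected A /\
  forall gamma : R -> point,
    {within `[0, 1], continuous gamma} -> gamma @` `[0, 1] `<=` A ->
    gamma 0 = gamma 1 ->
    exists H : R * R -> point,
      [/\ {within `[0, 1] `*` `[0, 1], continuous H},
          H @` (`[0, 1] `*` `[0, 1]) `<=` A,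
          forall t, t \in `[0, 1] -> H (0, t) = gamma t,
          forall t, t \in `[0, 1] -> H (1, t) = gamma 0 &
          forall s, s \in `[0, 1] -> H (s, 0) = gamma 0 /\ H (s, 1) = gamma 0].

End Operators.

(* Main.v *)
Require Import Defs.
From HB Require Import structures.
From mathcomp Require Import all_boot all_order all_algebra.
From mathcomp Require Import all_classical all_reals all_analysis.
From mathcomp Require Import complex.
From mathcomp Require Import ring lra.
Set Implicit Arguments.
Unset Strict Implicit.
Unset Printing Implicit Defensive.
Import Order.TTheory GRing.Theory Num.Theory.
Import numFieldNormedType.Exports.
Local Open Scope classical_set_scope.
Local Open Scope complex_scope.
Local Open Scope ring_scope.

(** Everything rests on the substitution f = f0 Psi. Split the first-order
equation for F = f0 grad Psi into its scalar and vector parts: with h = grad f0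
/ f0 they read div F + F . h = 0 and curl F + F x h = 0 ([first_order_coords]).
After multiplication by f0 the first one becomes div (f0^2 grad Psi) = 0, and
since f0 solves the Schroedinger equation this says exactly that f0 Psi solves
it too ([product_solution]). The second one is curl (F / f0) = 0, the
integrability condition of grad Psi = F / f0 ([potential_exists]). Conversely,
if f is a solution and Psi = f / f0, then F = f0 grad Psi satisfies both
equations, the second one because gradients are curl free
([solution_first_order]). Logarithmic derivatives add up along the product,
hence D (f0 Psi) / (f0 Psi) = h + g. Finally, any f with Df / f = q satisfies
Delta f = f sum_k (q_k^2 + d_k q_k), a factor that depends on q alone; its
value is read off from the solution f0 Psi ([log_antiderivative_laplacian],
[log_antiderivative_solution]).

The analytic difficulty is that the data are only differentiable at every
point: F, and the second derivatives of f, need not be continuous. Two theorems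
are needed at that level of regularity, the symmetry of second derivatives and
the Poincare lemma. Both come from one estimate ([segment_estimate_antisym]).
Let w be a 1-form with derivative D at z. Over a segment from z + p to z + q
that stays within distance M of z, the integral of w is a difference of values
of a quadratic function, plus (D p q - D q p) / 2, up to o(M) |q - p|. Around a
small triangle the differences cancel. If w is the differential of a function
the integrals cancel as well, so D must be symmetric
([form_derivative_symmetric]). If D is symmetric everywhere, the integral
around a triangle of size d about z is o(d^2), and the bisection argument of
Goursat shows that it vanishes around every triangle contained in a ball of the
domain ([line_integral_additive]).

From balls one passes to a simply connected domain by a statement free of
analysis ([cocycle_trivial]): a function W of pairs of points such that
W x y + W y z = W x z whenever x, y and z lie in one ball of the domain is of
the form W x y = Psi y - Psi x. The function W is summed along paths; a
null-homotopy of a loop transports the sum from each intermediate loop to the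
neighbouring ones without changing it, so it is zero for every loop. *)

(** * Paths and balls *)

(** Loops and homotopies on a closed interval or square are extended to the
whole line or plane by composing them with a retraction [g] onto [A]; this is
what keeps them continuous. *)
Lemma continuous_comp_within (T U W : topologicalType) (A : set U)
    (f : U -> W) (g : T -> U) :
  continuous g -> (forall x, A (g x)) -> {within A, continuous f} ->
  continuous (f \o g).
Proof.
move=> cg gA /subspace_continuousP cf x.
apply: cvg_comp (cf _ (gA x)) => B AB.
by apply: (@filterS _ (nbhs x) _ _ _ _ (cg x _ AB)) => y; apply; exact: gA.
Qed.

Section Clamp.
Variable R : realType.

Definition clamp (t : R) : R := Num.max 0 (Num.min t 1).

Lemma clamp_ge0 t : 0 <= clamp t.
Proof. by rewrite /clamp le_max lexx. Qed.

Lemma clamp_le1 t : clamp t <= 1.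
Proof. by rewrite /clamp ge_max ler01 ge_min lexx orbT. Qed.

Lemma clamp_itv t : clamp t \in `[0, 1].
Proof. by rewrite in_itv /= clamp_ge0 clamp_le1. Qed.

Lemma clamp_le0 t : t <= 0 -> clamp t = 0.
Proof.
by move=> t0; rewrite /clamp max_l // ge_min t0.
Qed.

Lemma clamp_ge1 t : 1 <= t -> clamp t = 1.
Proof. by move=> t1; rewrite /clamp min_r // max_r. Qed.

Lemma clamp_id t : 0 <= t <= 1 -> clamp t = t.
Proof. by move=> /andP[t0 t1]; rewrite /clamp min_l // max_r. Qed.

Lemma continuous_clamp : continuous clamp.
Proof.
move=> t; apply: (@continuous_max R R (cst 0) (fun s => Num.min s 1)).
  exact: cst_continuous.
apply: (@continuous_min R R id (cst 1)); first exact: cvg_id.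
exact: cst_continuous.
Qed.

End Clamp.

(** The indicator of a level set of a locally constant function has derivative
zero everywhere. The codomain is arbitrary, so that the lemma also applies to
families of propositions. *)
Lemma locally_constant (R : realType) (T : Type) (f : R -> T) :
  (forall s, \forall t \near s, f t = f s) -> forall s t, f s = f t.
Proof.
move=> fl s t; pose chi (x : R) : R := (`[< f x = f s >])%:R.
have : chi s = chi t.
  apply: is_derive_0_is_cst => x.
  apply: (@near_eq_is_derive _ _ _ (cst (chi x))).
  by near=> y; rewrite /chi /cst /=; rewrite (near (fl x) y).
by rewrite /chi asboolT //; case: asboolP => // _ /eqP; rewrite oner_eq0.
Unshelve. all: by end_near. Qed.

Section ConvexBall.
Variables (R : realType) (V : normedModType R).
Implicit Types (c x y : V) (r t : R).

Lemma ball_segment c r x y t : ball c r x -> ball c r y -> 0 <= t <= 1 ->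
  ball c r (x + t *: (y - x)).
Proof.
rewrite -ball_normE /= => xr yr /andP[t0 t1].
have -> : c - (x + t *: (y - x)) = (1 - t) *: (c - x) + t *: (c - y).
  rewrite scalerBl scale1r opprD addrA -[RHS]addrA; congr (_ + _).
  by rewrite -!scalerN -scalerDr !opprB addrA subrK.
rewrite (le_lt_trans (ler_normD _ _)) // !normrZ.
rewrite (ger0_norm t0) ger0_norm ?subr_ge0 //.
have [->|t_neq0] := eqVneq t 0; first by rewrite mul0r addr0 subr0 mul1r.
have t_gt0 : 0 < t by rewrite lt_neqAle eq_sym t_neq0.
have A : t * `|c - y| < t * r by rewrite ltr_pM2l.
have B : (1 - t) * `|c - x| <= (1 - t) * r.
  by rewrite ler_wpM2l ?subr_ge0 // ltW.
lra.
Qed.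

End ConvexBall.

(** * Locally additive cocycles *)

Section Cocycle.
Variables (R : realType) (V : normedModType R).
Variables (Omega : set V) (W : V -> V -> R).

Definition locally_additive := forall c r, ball c r `<=` Omega ->
  forall x y z, ball c r x -> ball c r y -> ball c r z -> W x y + W y z = W x z.

Hypothesis Omega_open : open Omega.
Hypothesis W_add : locally_additive.

Definition share_ball (x y : V) :=
  exists c r, [/\ ball c r `<=` Omega, ball c r x & ball c r y].

Lemma share_ball_sym x y : share_ball x y -> share_ball y x.
Proof. by move=> [c [r [? ? ?]]]; exists c, r. Qed.

Lemma near_share_ball x : Omega x -> \forall y \near x, share_ball x y.
Proof.
move=> Ox; have /nbhs_ballP[r r0 xr] := open_nbhs_nbhs (conj Omega_open Ox).
near=> y; exists x, r; split => //; first exact: ballxx.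
by near: y; exact: nbhsx_ballx.
Unshelve. all: by end_near. Qed.

Lemma near2_share_ball x : Omega x ->
  \forall y \near x & z \near x, share_ball y z.
Proof.
move=> Ox; have /nbhs_ballP[r r0 xr] := open_nbhs_nbhs (conj Omega_open Ox).
near=> y z; exists x, r; split => //.
  by near: y; exact: nbhsx_ballx.
by near: z; exact: nbhsx_ballx.
Unshelve. all: by end_near. Qed.

Lemma cocycle_diag x : Omega x -> W x x = 0.
Proof.
move=> Ox; have [c [r [s xc _]]] := nbhs_singleton (near_share_ball Ox).
by have := W_add s xc xc xc; rewrite -[RHS]addr0 => /addrI.
Qed.

(** [p] sums [W] along the path [g]. Only nearby parameters are compared, so no
subdivision of the path is ever chosen. *)
Definition potential_along (g : R -> V) (p : R -> R) :=
  forall t0, \forall t \near t0, p t - p t0 = W (g t0) (g t).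

Lemma potential_along_comp g p (th : R -> R) : continuous th ->
  potential_along g p -> potential_along (g \o th) (p \o th).
Proof. by move=> cth gp t0; exact: cth (gp _). Qed.

(** [c] is the sum of [W] along some path from [x] to [y]. The path and the sum
are constant outside the unit interval, which makes paths easy to
concatenate. *)
Definition reach (x y : V) (c : R) := exists (g : R -> V) (p : R -> R),
  [/\ continuous g, forall t, Omega (g t), potential_along g p,
      forall t, t <= 0 -> g t = x /\ p t = 0 &
      forall t, 1 <= t -> g t = y /\ p t = c].

Lemma reach_segment x y : share_ball x y -> reach x y (W x y).
Proof.
move=> [c [r [s xc yc]]].
pose g t := x + clamp t *: (y - x).
have gc t : ball c r (g t).
  by apply: ball_segment => //; rewrite clamp_ge0 clamp_le1.
have cg : continuous g.
  move=> t; rewrite /continuous_at /g; apply: cvgD; first exact: cvg_cst.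
  by apply: cvgZr_tmp; exact: continuous_clamp.
have g0 t : t <= 0 -> g t = x.
  by move=> t0; rewrite /g clamp_le0 // scale0r addr0.
have g1 t : 1 <= t -> g t = y.
  by move=> t0; rewrite /g clamp_ge1 // scale1r addrC subrK.
exists g, (fun t => W x (g t)); split => //.
- by move=> t; exact/s/gc.
- move=> t0; near=> t; rewrite -(W_add s xc (gc t0) (gc t)).
  by rewrite addrC addKr.
- by move=> t t0; rewrite g0 // cocycle_diag //; exact: s.
- by move=> t t1; rewrite g1.
Unshelve. all: by end_near. Qed.

Lemma reach_sym x y c : reach x y c -> reach y x (- c).
Proof.
move=> [g [p [cg gO gp g0 g1]]].
have crev : continuous (fun t : R => 1 - t).
  by move=> t; apply: cvgB; [exact: cvg_cst|exact: cvg_id].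
exists (g \o (fun t => 1 - t)), (fun t => p (1 - t) - c); split => //.
- by move=> t; apply: continuous_comp; [exact: crev|exact: cg].
- by move=> t; exact: gO.
- move=> t0; have := potential_along_comp crev gp t0.
  by apply: filterS => t /= <-; ring.
- move=> t t0; have [|/= -> ->] := g1 (1 - t); first by lra.
  by rewrite subrr.
- move=> t t0; have [|/= -> ->] := g0 (1 - t); first by lra.
  by rewrite sub0r.
Qed.

(** Since [g] has reached [y] when [h] leaves it, the sum [g + h - y] of the two
reparametrized paths is their concatenation, and its continuity is immediate. *)
Lemma reach_trans x y z c d : reach x y c -> reach y z d -> reach x z (c + d).
Proof.
move=> [g [p [cg gO gp g0 g1]]] [h [q [ch hO hq h0 h1]]].
pose l (t : R) := 2 * t; pose r (t : R) := 2 * t - 1.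
have cl : continuous l.
  by move=> t; apply: cvgM; [exact: cvg_cst|exact: cvg_id].
have cr : continuous r.
  by move=> t; apply: cvgB; [exact: cl|exact: cvg_cst].
pose k t := g (l t) + h (r t) - y; pose m t := p (l t) + q (r t).
have kl t : t <= 2^-1 -> k t = g (l t) /\ m t = p (l t).
  move=> t2; rewrite /k /m; have [|-> ->] := h0 (r t); first by rewrite /r; lra.
  by rewrite addrK addr0.
have kr t : 2^-1 <= t -> k t = h (r t) /\ m t = c + q (r t).
  move=> t2; rewrite /k /m; have [|-> ->] := g1 (l t); first by rewrite /l; lra.
  by rewrite addrC addKr.
exists k, m; split.
- move=> t; apply: cvgB; last exact: cvg_cst.
  apply: cvgD; apply: continuous_comp;
    [exact: cl|exact: cg|exact: cr|exact: ch].
- move=> t; have [/kl[-> _] //|/ltW/kr[-> _] //] := leP t 2^-1.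
- move=> t0; have A := potential_along_comp cl gp t0.
  have B := potential_along_comp cr hq t0.
  have S : \forall t \near t0,
      (t <= 2^-1 /\ t0 <= 2^-1) \/ (2^-1 <= t /\ 2^-1 <= t0).
    have [t0l|t0r|t0e] := ltgtP t0 (2^-1 : R).
    + near=> t; left; split => //.
      by apply/ltW; near: t; exact: lt_nbhsl.
    + near=> t; right; split => //.
      by apply/ltW; near: t; exact: lt_nbhsr.
    + by near=> t; have [|/ltW] := leP t (2^-1 : R); [left|right].
  near=> t.
  have : (t <= 2^-1 /\ t0 <= 2^-1) \/ (2^-1 <= t /\ 2^-1 <= t0) by near: t.
  case=> -[].
    by move=> /kl[-> ->] /kl[-> ->]; near: t.
  move=> /kr[-> ->] /kr[-> ->].
  by rewrite opprD addrACA subrr add0r; near: t.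
- move=> t t0; have [|-> ->] := kl t; first by lra.
  by apply: g0; rewrite /l; lra.
- move=> t t1; have [|-> ->] := kr t; first by lra.
  by have [|-> ->] := h1 (r t); first by rewrite /r; lra.
Unshelve. all: by end_near. Qed.

(** Moving a path by a small amount changes the sum by the values of [W] between
corresponding points: the four points involved near a given parameter lie in
one ball. *)
Lemma potential_along_transport g h p : continuous g -> continuous h ->
  (forall t, share_ball (g t) (h t)) -> potential_along g p ->
  potential_along h (fun t => p t + W (g t) (h t)).
Proof.
move=> cg ch gh gp t0; have [c [r [s gc hc]]] := gh t0.
have bo z : ball c r z -> nbhs z (ball c r).
  by move=> zc; apply: open_nbhs_nbhs; split => //; exact: ball_open.
near=> t.
have gt : ball c r (g t) by near: t; exact/cg/bo.
have ht : ball c r (h t) by near: t; exact/ch/bo.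
have -> : p t + W (g t) (h t) - (p t0 + W (g t0) (h t0)) =
  (p t - p t0) + W (g t) (h t) - W (g t0) (h t0) by ring.
rewrite (near (gp t0) t) //.
by rewrite (W_add s gc gt ht) -(W_add s gc hc ht) addrC addKr.
Unshelve. all: by end_near. Qed.

(** Both the points that can be reached from [x] and those that cannot form open
sets, because each point reaches every point that shares a ball with it. *)
Lemma connected_reach : connected Omega ->
  forall x y, Omega x -> Omega y -> exists c, reach x y c.
Proof.
move=> Oc x y Ox Oy.
(* Openness relative to Omega and closedness relative to Omega of S are
   obtained from the open sets near_with S and near_with (~` S). *)
pose near_with (P : V -> Prop) := \bigcup_(z in [set z | Omega z /\ P z])
  [set w | share_ball z w].
have near_with_open P : open (near_with P).
  apply: bigcup_open => z _; rewrite openE => w [c [r [s zc wc]]].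
  have /open_nbhs_nbhs : open_nbhs w (ball c r).
    by split => //; exact: ball_open.
  by apply: filterS => v vc; exists c, r.
pose S := [set z | exists c, reach x z c].
have share_refl z : Omega z -> share_ball z z.
  by move=> /near_share_ball/nbhs_singleton.
have SN : Omega `&` near_with S = Omega `&` S.
  apply/seteqP; split => z [Oz].
    move=> [w [Ow [c xw]] wz]; split => //; exists (c + W w z).
    exact/(reach_trans xw)/reach_segment.
  by move=> Sz; split => //; exists z => //; exact: share_refl.
have SC : Omega `&` ~` near_with (~` S) = Omega `&` S.
  apply/seteqP; split => z [Oz].
    move=> Nz; split => //; apply: contrapT => nSz; apply: Nz.
    by exists z => //; exact: share_refl.
  move=> [c xz]; split => // -[w [Ow nSw] wz]; apply: nSw.
  by exists (c + W z w); exact/(reach_trans xz)/reach_segment/share_ball_sym.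
suff : Omega `&` S = Omega by move=> /seteqP[_ /(_ y Oy)[]].
apply: Oc.
- exists x; split => //; exists (W x x).
  exact/reach_segment/share_refl.
- by exists (near_with S).
- by exists (~` near_with (~` S)) => //; exact: open_closedC.
Qed.

End Cocycle.

Section SimplyConnected.
Variables (R : realType) (Omega : set 'rV[R]_3).
Variable W : 'rV[R]_3 -> 'rV[R]_3 -> R.
Hypothesis Omega_open : open Omega.
Hypothesis W_add : locally_additive Omega W.
Hypothesis Omega_sc : simply_connected Omega.

(** Along a null-homotopy [H] the property that the sum along [H (s, _)] equals
[c] is locally constant in [s]. It holds at [s = 0], and at [s = 1] the
loop is constant, so [c = 0]. *)
Lemma reach_loop x c : reach Omega W x x c -> c = 0.
Proof.
move=> [g [p [cg gO gp g0 g1]]].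
have [_ /(_ g)] := Omega_sc; case.
- exact: continuous_subspaceT.
- by move=> _ [t _ <-]; exact: gO.
- by rewrite (g0 0 (lexx _)).1 (g1 1 (lexx _)).1.
move=> H [cH HO H0 H1 Hside].
pose K (s t : R) : 'rV[R]_3 := H (clamp s, clamp t).
have clampP s t : (`[0, 1] `*` `[0, 1])%classic (clamp s, clamp t : R).
  by split; exact: clamp_itv.
have cK : continuous (fun st : R * R => K st.1 st.2).
  apply: (continuous_comp_within _ _ cH) => [st|st]; last exact: clampP.
  apply: (@cvg_pair _ _ _ _ (nbhs (clamp st.1)) (nbhs (clamp st.2))).
    by apply: continuous_comp; [exact: cvg_fst|exact: continuous_clamp].
  by apply: continuous_comp; [exact: cvg_snd|exact: continuous_clamp].
have KO s t : Omega (K s t) by apply: HO; exists (clamp s, clamp t).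
have cKs s : continuous (K s).
  move=> t; apply: (@continuous_comp _ _ _ (fun t : R => (s, t))
    (fun st : R * R => K st.1 st.2)).
    by apply: (@cvg_pair _ _ _ _ (nbhs s) (nbhs t));
      [exact: cvg_cst|exact: cvg_id].
  exact: cK.
pose Q s := exists q, [/\ potential_along W (K s) q, q 0 = 0 & q 1 = c].
have K0 s : K s 0 = x.
  rewrite /K (clamp_le0 (lexx 0)) (Hside _ (clamp_itv s)).1.
  exact: (g0 0 (lexx _)).1.
have K1 s : K s 1 = x.
  rewrite /K (clamp_ge1 (lexx 1)) (Hside _ (clamp_itv s)).2.
  exact: (g0 0 (lexx _)).1.
have WKK z : Omega z -> W z z = 0 by exact: cocycle_diag.
have Ox : Omega x by rewrite -(K0 0); exact: KO.
have Qstep s s' : (forall t, share_ball Omega (K s t) (K s' t)) -> Q s -> Q s'.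
  move=> ss' [q [qK q0 q1]].
  exists (fun t => q t + W (K s t) (K s' t)); split.
  - exact: (potential_along_transport W_add (cKs s) (cKs s') ss' qK).
  - by rewrite q0 !K0 WKK ?addr0.
  - by rewrite q1 !K1 WKK ?addr0.
(* By compactness of the unit interval, for s near s0 the points K s t and
   K s0 t share a ball for all t at once. *)
have Qloc s0 : \forall s \near s0, Q s = Q s0.
  have /compact_near_coveringP cover := @segment_compact R 0 1.
  have : \forall s \near s0,
      (`[0, 1] `<=` [set t | share_ball Omega (K s t) (K s0 t)])%classic.
    apply: (cover _ (nbhs s0) (fun s t => share_ball Omega (K s t) (K s0 t))).
    move=> t0 _.
    have := near2_share_ball Omega_open (KO s0 t0) => -[[A B] /= [KA KB] AB].
    have [[A1 A2] /= [A1n A2n] A12] := cK (s0, t0) _ KA.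
    exists (A2 `&` [set t | B (K s0 t)], A1) => /=.
      by split => //; apply: filterI => //; exact: cKs KB.
    by move=> [t s] /= [[tA2 tB] sA1]; apply: (AB (_, _)); split => //;
      exact: (A12 (s, t)).
  apply: filterS => s sh; rewrite propeqE.
  have shT t : share_ball Omega (K s t) (K s0 t).
    have tt : 0 <= clamp t <= 1 by rewrite clamp_ge0 clamp_le1.
    by have := sh (clamp t) (clamp_itv t); rewrite /= /K (clamp_id tt).
  by split; apply: Qstep => t //; exact/share_ball_sym.
have Q0 : Q 0.
  exists (p \o @clamp R); split => /=.
  - suff -> : K 0 = g \o @clamp R.
      exact: (potential_along_comp (@continuous_clamp R)).
    by apply/funext => t; rewrite /K (clamp_le0 (lexx 0)) /= H0 // clamp_itv.
  - by rewrite (clamp_le0 (lexx 0)); exact: (g0 0 (lexx _)).2.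
  - by rewrite (clamp_ge1 (lexx 1)); exact: (g1 1 (lexx _)).2.
have [q [qK q0 q1]] : Q 1 by rewrite (locally_constant Qloc 1 0).
have K1x t : K 1 t = x.
  by rewrite /K (clamp_ge1 (lexx 1)) H1 ?clamp_itv // (g0 0 (lexx _)).1.
rewrite -q1 -q0; apply: locally_constant => t.
have := qK t; apply: filterS => u.
by rewrite !K1x WKK // => /eqP; rewrite subr_eq0 => /eqP.
Qed.

(** [Psi x] is the sum of [W] along any path from a base point to [x]; two such
paths form a loop. *)
Theorem cocycle_trivial : exists Psi : 'rV[R]_3 -> R,
  forall x y, share_ball Omega x y -> Psi y - Psi x = W x y.
Proof.
have [[x0 Ox0]|Oempty] := pselect (Omega !=set0); last first.
  exists (cst 0) => x y [c [r [s xc _]]].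
  by case: Oempty; exists x; exact: s.
have [Oc _] := Omega_sc.
have /choice[Psi PsiP] : forall x, exists c, Omega x -> reach Omega W x0 x c.
  move=> x; have [Ox|nOx] := pselect (Omega x); last by exists 0.
  by have [c xc] := connected_reach Omega_open W_add Oc Ox0 Ox; exists c.
exists Psi => x y xy.
have [Ox Oy] : Omega x /\ Omega y.
  by have [c [r [s xc yc]]] := xy; split; exact: s.
have := reach_trans (PsiP x Ox) (reach_trans
  (reach_segment Omega_open W_add xy) (reach_sym (PsiP y Oy))).
by move=> /reach_loop; lra.
Qed.

End SimplyConnected.

(** * Integrals of 1-forms along segments *)

Section UnitInterval.
Variable R : realType.
Implicit Types f phi : R -> R.

Lemma in01_0 : (0 : R) \in `[0, 1].
Proof. by rewrite in_itv /= lexx ler01. Qed.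

Lemma in01_1 : (1 : R) \in `[0, 1].
Proof. by rewrite in_itv /= lexx ler01. Qed.

Lemma in01_half : (2^-1 : R) \in `[0, 1].
Proof. by rewrite in_itv /=; apply/andP; split; lra. Qed.

Definition primitive01 f phi :=
  forall t : R, t \in `[0, 1] -> is_derive t 1 phi (f t).

Definition integral01 f : R := (\int[lebesgue_measure]_(t in `[0, 1]) f t)%R.

Lemma primitive01_within_continuous f phi (s t : R) : 0 <= s -> t <= 1 ->
  primitive01 f phi -> {within `[s, t], continuous phi}.
Proof.
move=> s0 t1 fphi; apply: derivable_within_continuous => x.
rewrite in_itv /= => /andP[sx xt]; have [|//] := fphi x.
by rewrite in_itv /= (le_trans s0) //= (le_trans xt).
Qed.

Lemma integral01_primitive f phi :
  (forall t : R, t \in `[0, 1] -> {for t, continuous f}) ->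
  primitive01 f phi -> integral01 f = phi 1 - phi 0.
Proof.
move=> cf fphi.
have in01 (t : R) : t \in `]0, 1[ -> t \in `[0, 1].
  by apply: subset_itv_oo_cc.
rewrite /integral01 /Rintegral (@continuous_FTC2 _ f phi) ?ltr01 //.
- apply: continuous_in_subspaceT => t /set_mem/cf; exact.
- have c01 (t : R) : t \in `[0, 1] -> {for t, continuous phi}.
    move=> /fphi[dphi _].
    exact/differentiable_continuous/derivable1_diffP.
  split.
  + by move=> t /in01/fphi[].
  + by apply: cvg_at_right_filter; apply: c01; exact: in01_0.
  + by apply: cvg_at_left_filter; apply: c01; exact: in01_1.
- by move=> t /in01/fphi[_ <-]; rewrite derive1E.
Qed.

(** Outside the unit interval [f] is frozen at its end values, so that the
fundamental theorem of calculus applies at the end points as well. *)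
Lemma primitive01_exists f :
  (forall t : R, t \in `[0, 1] -> {for t, continuous f}) ->
  exists phi, primitive01 f phi.
Proof.
move=> cf; pose g := f \o @clamp R.
have cg : continuous g.
  move=> t; apply: continuous_comp; first exact: continuous_clamp.
  exact: cf (clamp_itv t).
have ig : lebesgue_measure.-integrable `[-1, 2] (EFin \o g).
  apply: continuous_compact_integrable; first exact: segment_compact.
  exact: continuous_subspaceT.
exists (fun x => (\int[lebesgue_measure]_(t in `[(-1)%R, x]) g t)%R) => t.
rewrite in_itv /= => /andP[t0 t1].
have [|||dF F't] := @continuous_FTC1_closed R g (-1) t 2 _ ig.
- by rewrite (le_lt_trans t1) // ltr1n.
- by rewrite (lt_le_trans _ t0) // ltrN10.
- exact: cg.
apply: DeriveDef => //.
by rewrite -derive1E F't /g /= clamp_id // t0.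
Qed.

(** Reversal and subdivision of a segment are both instances of this affine
reparametrization. *)
Lemma primitive01_affine f phi (s u : R) : s \in `[0, 1] -> u \in `[0, 1] ->
  primitive01 f phi ->
  primitive01 (fun t => (u - s) * f (s + t * (u - s)))
              (fun t => phi (s + t * (u - s))).
Proof.
rewrite !in_itv /= => /andP[s0 s1] /andP[u0 u1] fphi t.
rewrite in_itv /= => /andP[t0 t1].
have aff : is_derive t (1 : R) (fun t => s + t * (u - s)) (u - s).
  apply: is_derive_eq.
  by rewrite /GRing.scale /=; ring.
have d : is_derive (s + t * (u - s)) (1 : R) phi (f (s + t * (u - s))).
  apply: fphi; rewrite in_itv /=; apply/andP; split; nra.
have := is_derive1_comp (f := phi) (g := fun t => s + t * (u - s)).
by move=> /(_ t _ _ d aff); rewrite mulrC.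
Qed.

(** The mean value theorem, read as a bound on integrals. *)
Lemma primitive01_bound f phi (e : R) : primitive01 f phi ->
  (forall t : R, t \in `[0, 1] -> `|f t| <= e) -> `|phi 1 - phi 0| <= e.
Proof.
move=> fphi fe; have [t t01 ->] : exists2 t : R, t \in `[0, 1] &
    phi 1 - phi 0 = f t * (1 - 0).
  apply: MVT_segment; first exact: ler01.
    by move=> t /subset_itv_oo_cc/fphi.
  exact: primitive01_within_continuous fphi.
by rewrite subr0 mulr1; exact: fe.
Qed.

End UnitInterval.

Arguments in01_0 {R}.
Arguments in01_1 {R}.
Arguments in01_half {R}.

Section LinearForms.
Variables (R : realType) (V : normedModType R).

Definition lin (f : V -> R) := forall a u v, f (a *: u + v) = a * f u + f v.

Section LinTheory.
Variables (f : V -> R) (f_lin : lin f).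

Lemma lin0 : f 0 = 0.
Proof. by have := f_lin 1 0 0; rewrite scaler0 addr0 mul1r; lra. Qed.

Lemma linZ a u : f (a *: u) = a * f u.
Proof. by rewrite -[a *: u]addr0 f_lin lin0 addr0. Qed.

Lemma linD u v : f (u + v) = f u + f v.
Proof. by rewrite -[u]scale1r f_lin mul1r scale1r. Qed.

Lemma linN u : f (- u) = - f u.
Proof. by rewrite -scaleN1r linZ mulN1r. Qed.

Lemma linB u v : f (u - v) = f u - f v.
Proof. by rewrite linD linN. Qed.

End LinTheory.

Definition bilin (D : V -> V -> R) :=
  (forall u, lin (D u)) /\ (forall v, lin (D ^~ v)).

Implicit Types (w D : V -> V -> R) (a b c z : V).

(** A 1-form is a function [w] of a point and a vector, linear in the vector.
Here [w] is replaced near [z] by its first-order expansion, with relative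
error [e] on [A]. *)
Definition form_approx w D z e (A : set V) := forall x, A x -> forall v,
  `|w x v - w z v - D (x - z) v| <= e * `|x - z| * `|v|.

Definition form_derivative w z D := bilin D /\
  forall e, 0 < e -> \forall M \near (0 : R)^'+,
    form_approx w D z e [set x | `|x - z| <= M].

Definition segment a b (t : R) := a + t *: (b - a).

(** The pull-back of the 1-form [w] to the segment from [a] to [b]. *)
Definition form_on w a b (t : R) := w (segment a b t) (b - a).

Lemma norm_segment_le a b z M t : t \in `[0, 1] ->
  `|a - z| <= M -> `|b - z| <= M -> `|segment a b t - z| <= M.
Proof.
rewrite in_itv /= => /andP[t0 t1] az bz.
have -> : segment a b t - z = (1 - t) *: (a - z) + t *: (b - z).
  rewrite /segment scalerBl scale1r -[RHS]addrA -scalerN -scalerDr opprB.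
  by rewrite [z - a + _]addrC addrA subrK addrAC.
rewrite (le_trans (ler_normD _ _)) // !normrZ (ger0_norm t0).
rewrite ger0_norm ?subr_ge0 //.
have A : t * `|b - z| <= t * M by rewrite ler_wpM2l.
have B : (1 - t) * `|a - z| <= (1 - t) * M by rewrite ler_wpM2l ?subr_ge0.
lra.
Qed.

(** Subtracting from [phi] the primitive of the first-order expansion of [w]
leaves a function whose derivative is at most [e * M * `|b - a|]. *)
Lemma segment_estimate w D z e M a b phi : 0 <= e -> bilin D ->
  form_approx w D z e [set x | `|x - z| <= M] ->
  `|a - z| <= M -> `|b - z| <= M ->
  primitive01 (form_on w a b) phi ->
  `|phi 1 - phi 0
    - (w z (b - a) + D (a - z) (b - a) + 2^-1 * D (b - a) (b - a))|
  <= e * M * `|b - a|.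
Proof.
move=> e0 [Dr Dl] wD az bz phiP; set v := b - a.
pose psi t := phi t - (t * (w z v + D (a - z) v) + t ^+ 2 * (2^-1 * D v v)).
have psiP : primitive01
    (fun t => form_on w a b t - (w z v + D (a - z) v + t * D v v)) psi.
  move=> t t01; have phit := phiP t t01; rewrite /psi.
  apply: is_derive_eq.
  by rewrite /GRing.scale /=; field.
have -> : phi 1 - phi 0 - (w z v + D (a - z) v + 2^-1 * D v v) = psi 1 - psi 0.
  by rewrite /psi; ring.
apply: primitive01_bound psiP _ => t t01.
have -> : w z v + D (a - z) v + t * D v v = w z v + D (segment a b t - z) v.
  have -> : segment a b t - z = t *: v + (a - z).
    by rewrite /segment addrAC addrC.
  by rewrite (Dl v); ring.
have sM := norm_segment_le t01 az bz.
rewrite opprD addrA (le_trans (wD _ sM _)) //.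
by rewrite ler_wpM2r // ler_wpM2l.
Qed.

Lemma eq_of_le_eps (x y C : R) :
  (forall e, 0 < e -> `|x - y| <= e * C) -> x = y.
Proof.
move=> H; apply/eqP; rewrite -subr_eq0 -normr_eq0 eq_le normr_ge0 andbT.
have C0 : 0 <= C by have := H 1 ltr01; rewrite mul1r; exact: le_trans.
apply/ler_addgt0Pl => e e0; rewrite addr0.
have C1 : 0 < C + 1 by lra.
rewrite (le_trans (H (e / (C + 1)) _)) ?divr_gt0 //.
by rewrite mulrAC ler_pdivrMr // ler_wpM2l ?ltW //; lra.
Qed.

Lemma segment0 a b : segment a b 0 = a.
Proof. by rewrite /segment scale0r addr0. Qed.

Lemma segment1 a b : segment a b 1 = b.
Proof. by rewrite /segment scale1r addrC subrK. Qed.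

(** Up to the last summand, the main term is a difference of values of
[fun r => w z r + 2^-1 * D r r], so it cancels around any closed polygon; what
remains is the area term [D p q - D q p]. *)
Lemma segment_estimate_antisym w D z e M p q phi : 0 <= e ->
  lin (w z) -> bilin D ->
  form_approx w D z e [set x | `|x - z| <= M] ->
  `|p| <= M -> `|q| <= M ->
  primitive01 (form_on w (z + p) (z + q)) phi ->
  `|phi 1 - phi 0 - ((w z q + 2^-1 * D q q) - (w z p + 2^-1 * D p p)
                     + 2^-1 * (D p q - D q p))|
  <= e * M * `|q - p|.
Proof.
move=> e0 wl [Dr Dl] wD pM qM phiP.
have zp (r : V) : z + r - z = r by rewrite addrC addKr.
have qp : z + q - (z + p) = q - p by rewrite opprD addrACA subrr add0r.
have := segment_estimate e0 (conj Dr Dl) wD _ _ phiP.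
rewrite !zp qp => /(_ pM qM); congr (`|_ - _| <= _).
by rewrite (linB wl) !(linB (Dr _)) (linB (Dl q)) (linB (Dl p)); field.
Qed.

(** If [w] integrates to differences of values of [f], the estimates for the
sides of the triangle with vertices [z], [z + t *: u] and [z + t *: v] add up to
[t ^+ 2 * `|D u v - D v u| <= e * O(t ^+ 2)]. Both the sides and the distances
to [z] are at most [M = t * (N + 1)]. *)
Lemma form_derivative_symmetric w D z (f : V -> R) : (forall x, lin (w x)) ->
  form_derivative w z D ->
  (\forall M \near (0 : R)^'+, forall a b, `|a - z| <= M -> `|b - z| <= M ->
     primitive01 (form_on w a b) (f \o segment a b)) ->
  forall u v, D u v = D v u.
Proof.
move=> wl [Db wD] fw u v; have [Dr Dl] := Db.
pose N := `|u| + `|v|; have N0 : 0 <= N by rewrite addr_ge0.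
have N1 : 0 < N + 1 by lra.
apply: (@eq_of_le_eps _ _ (4 * (N + 1) * N)) => e e0.
near (0 : R)^'+ => M.
have M0 : 0 < M by [].
have wDM : form_approx w D z e [set x | `|x - z| <= M].
  by near: M; exact: wD.
have fwM : forall a b, `|a - z| <= M -> `|b - z| <= M ->
     primitive01 (form_on w a b) (f \o segment a b) by near: M; exact: fw.
pose t := M / (N + 1).
have t0 : 0 < t by rewrite divr_gt0.
have MtN : M = t * (N + 1) by rewrite /t divfK // gt_eqF.
have zp (r : V) : z + r - z = r by rewrite addrC addKr.
have edge (p q : V) : `|p| <= N -> `|q| <= N ->
  `|f (z + t *: q) - f (z + t *: p) -
     (t * (w z q - w z p) + t ^+ 2 * (2^-1 * (D q q - D p p))
      + t ^+ 2 * (2^-1 * (D p q - D q p)))| <= e * M * (t * `|q - p|).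
  move=> pN qN.
  have scM (r : V) : `|r| <= N -> `|t *: r| <= M.
    by move=> rN; rewrite normrZ gtr0_norm // MtN ler_pM2l //; lra.
  have := @segment_estimate_antisym w D z e M (t *: p) (t *: q)
    (f \o segment (z + t *: p) (z + t *: q)) (ltW e0) (wl z) Db wDM
    (scM _ pN) (scM _ qN).
  rewrite -scalerBr normrZ (gtr0_norm t0) /= segment0 segment1.
  have tm : forall r s, D (t *: r) (t *: s) = t ^+ 2 * D r s.
    by move=> r s; rewrite (linZ (Dr _)) (linZ (Dl _)); ring.
  rewrite !tm !(linZ (wl z)) => H; apply: le_trans (H _); last first.
    by apply: fwM; rewrite zp; exact: scM.
  rewrite le_eqVlt; apply/orP; left; apply/eqP; congr `|_|; ring.
have uN : `|u| <= N by rewrite lerDl.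
have vN : `|v| <= N by rewrite lerDr.
have zN : `|0 : V| <= N by rewrite normr0.
have := edge 0 u zN uN; have := edge u v uN vN; have := edge v 0 vN zN.
rewrite subr0 sub0r normrN !(lin0 (wl z)) !(lin0 (Dr _)) !(lin0 (Dl _)).
rewrite scaler0 addr0 => E3 E2 E1.
have uvN : `|v - u| <= N by rewrite (le_trans (ler_normB _ _)) // addrC.
have sum : t ^+ 2 * (2^-1 * `|D u v - D v u|)
           <= t ^+ 2 * (e * (N + 1) * (2 * N)).
  have -> : t ^+ 2 * (2^-1 * `|D u v - D v u|) =
            `|t ^+ 2 * (2^-1 * (D u v - D v u))|.
    rewrite [RHS]normrM [`|2^-1 * _|]normrM.
    by rewrite (gtr0_norm (exprn_gt0 2 t0)) (@gtr0_norm _ 2^-1).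
  have B : e * M * (t * `|v|) + e * M * (t * `|v - u|) + e * M * (t * `|u|)
           <= t ^+ 2 * (e * (N + 1) * (2 * N)).
    have -> : t ^+ 2 * (e * (N + 1) * (2 * N)) = e * M * (t * (N + N)).
      by rewrite MtN; ring.
    rewrite -!mulrDr (ler_pM2l (mulr_gt0 e0 M0)) (ler_pM2l t0).
    by rewrite /N in uvN *; lra.
  apply: le_trans B.
  move: E1 E2 E3; rewrite !ler_norml.
  by move=> /andP[? ?] /andP[? ?] /andP[? ?]; lra.
have t2 : 0 < t ^+ 2 by rewrite exprn_gt0.
by rewrite ler_pM2l // in sum; lra.
Unshelve. all: by end_near. Qed.

End LinearForms.

Section LineIntegral.
Variables (R : realType) (V : normedModType R) (w : V -> V -> R).
Hypothesis w_lin : forall x, lin (w x).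
Variables (c0 : V) (r : R).
Local Notation B := (ball c0 r).
Hypothesis w_cont : forall x, B x -> forall v, {for x, continuous (w ^~ v)}.

Definition line_integral a b := integral01 (form_on w a b).

Lemma continuous_segment (a b : V) : continuous (segment a b).
Proof.
move=> t; apply: cvgD; first exact: cvg_cst.
by apply: cvgZr_tmp; exact: cvg_id.
Qed.

Lemma ball_segment01 a b t : B a -> B b -> t \in `[0, 1] -> B (segment a b t).
Proof. by move=> ? ?; rewrite in_itv; exact: ball_segment. Qed.

Lemma form_on_continuous a b : B a -> B b ->
  forall t : R, t \in `[0, 1] -> {for t, continuous (form_on w a b)}.
Proof.
move=> Ba Bb t t01.
apply: (@continuous_comp _ _ _ (segment a b) (w ^~ (b - a))).
  exact: continuous_segment.
exact/w_cont/ball_segment01.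
Qed.

Lemma line_integralE a b phi : B a -> B b ->
  primitive01 (form_on w a b) phi -> line_integral a b = phi 1 - phi 0.
Proof.
by move=> Ba Bb; apply: integral01_primitive; exact: form_on_continuous.
Qed.

(** A single primitive serves for all subsegments, so that reversing or
bisecting a segment comes down to identities between the values of [phi]. *)
Lemma line_integral_primitive a b : B a -> B b -> exists phi,
  primitive01 (form_on w a b) phi /\
  forall s u : R, s \in `[0, 1] -> u \in `[0, 1] ->
    line_integral (segment a b s) (segment a b u) = phi u - phi s.
Proof.
move=> Ba Bb; have [phi phiP] := primitive01_exists (form_on_continuous Ba Bb).
exists phi; split => // s u s01 u01.
have := line_integralE (ball_segment01 Ba Bb s01) (ball_segment01 Ba Bb u01).
move=> /(_ (fun t => phi (s + t * (u - s)))); rewrite mul1r mul0r addr0.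
rewrite [s + _]addrC subrK; apply.
have sub : segment a b u - segment a b s = (u - s) *: (b - a).
  by rewrite /segment opprD addrACA subrr add0r scalerBl.
have -> : form_on w (segment a b s) (segment a b u) =
          fun t => (u - s) * form_on w a b (s + t * (u - s)).
  apply/funext => t; rewrite /form_on sub (linZ (w_lin _)).
  congr (_ * w _ _).
  by rewrite {1}/segment sub /segment scalerA scalerDl addrA.
exact: primitive01_affine.
Qed.

Lemma line_integral_rev a b : B a -> B b ->
  line_integral b a = - line_integral a b.
Proof.
move=> Ba Bb; have [phi [_ phiP]] := line_integral_primitive Ba Bb.
have := phiP 1 0 in01_1 in01_0; have := phiP 0 1 in01_0 in01_1.
by rewrite segment0 segment1 => -> ->; rewrite opprB.
Qed.

Definition midpoint (a b : V) := segment a b 2^-1.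

Lemma line_integral_split a b : B a -> B b ->
  line_integral a b =
  line_integral a (midpoint a b) + line_integral (midpoint a b) b.
Proof.
move=> Ba Bb; have [phi [_ phiP]] := line_integral_primitive Ba Bb.
have := phiP _ _ in01_0 in01_1; have := phiP _ _ in01_0 in01_half.
have := phiP _ _ in01_half in01_1.
by rewrite segment0 segment1 => -> -> ->; ring.
Qed.

End LineIntegral.

(** * Goursat's theorem *)

Section Triangles.
Variables (R : realType) (V : normedModType R) (I : V -> V -> R).
Implicit Types a b c : V.

Definition triangle : Type := (V * V * V)%type.
Implicit Type T : triangle.

Definition perimeter T : R :=
  `|T.1.2 - T.1.1| + `|T.2 - T.1.2| + `|T.1.1 - T.2|.

Definition circulation T : R := I T.1.1 T.1.2 + I T.1.2 T.2 + I T.2 T.1.1.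

Definition vertices_in (K : set V) T := [/\ K T.1.1, K T.1.2 & K T.2].

(** The four triangles cut out by the midpoints of the sides, oriented so that
the contributions of the inner sides cancel. *)
Definition child T T' :=
  [\/ T' = (T.1.1, midpoint T.1.1 T.1.2, midpoint T.2 T.1.1),
      T' = (midpoint T.1.1 T.1.2, T.1.2, midpoint T.1.2 T.2),
      T' = (midpoint T.2 T.1.1, midpoint T.1.2 T.2, T.2) |
      T' = (midpoint T.1.1 T.1.2, midpoint T.1.2 T.2, midpoint T.2 T.1.1)].

Lemma midpoint_subl a b : midpoint a b - a = 2^-1 *: (b - a).
Proof. by rewrite /midpoint /segment addrC addKr. Qed.

Lemma midpoint_subr a b : b - midpoint a b = 2^-1 *: (b - a).
Proof.
rewrite /midpoint /segment opprD addrA -{1}[b - a]scale1r -scalerBl.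
by congr (_ *: _); lra.
Qed.

Lemma midpoint_distl a b : `|midpoint a b - a| = 2^-1 * `|b - a|.
Proof. by rewrite midpoint_subl normrZ ger0_norm. Qed.

Lemma midpoint_distr a b : `|b - midpoint a b| = 2^-1 * `|b - a|.
Proof. by rewrite midpoint_subr normrZ ger0_norm. Qed.

Lemma midpoint_dist a b c :
  `|midpoint b c - midpoint a b| = 2^-1 * `|c - a|.
Proof.
have -> : midpoint b c - midpoint a b = (midpoint b c - b) + (b - midpoint a b).
  by rewrite addrA subrK.
rewrite midpoint_subl midpoint_subr -scalerDr addrA subrK normrZ.
by rewrite ger0_norm.
Qed.

Lemma child_perimeter T T' : child T T' -> perimeter T' = 2^-1 * perimeter T.
Proof.
case: T => -[a b] c; rewrite /child /perimeter /=; case=> -> /=.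
- rewrite midpoint_distl (distrC (midpoint c a)) midpoint_dist.
  by rewrite midpoint_distr (distrC c b); ring.
- rewrite midpoint_distr midpoint_distl (distrC (midpoint a b)).
  by rewrite midpoint_dist (distrC a c); ring.
- rewrite (distrC (midpoint b c)) midpoint_dist midpoint_distr.
  by rewrite midpoint_distl (distrC b a); ring.
- rewrite !midpoint_dist (distrC b a) (distrC c b) (distrC a c); ring.
Qed.

Lemma child_vertices (K : set V) T T' :
  (forall x y, K x -> K y -> K (midpoint x y)) ->
  child T T' -> vertices_in K T -> vertices_in K T'.
Proof.
move=> Kmid TT' [Ka Kb Kc].
by case: TT' => ->; split; rewrite //=; apply: Kmid.
Qed.

(** Bounding the displacement of the first vertex by a difference of perimeters
makes the bound telescope along a nested sequence of triangles. *)
Lemma child_drift T T' : child T T' ->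
  `|T'.1.1 - T.1.1| <= perimeter T - perimeter T'.
Proof.
move=> TT'; rewrite (child_perimeter TT').
case: T TT' => -[a b] c; rewrite /child /perimeter /=.
have A := normr_ge0 (b - a); have B := normr_ge0 (c - b).
have C := normr_ge0 (a - c).
case=> -> /=; rewrite ?subrr ?normr0 ?midpoint_distl
  ?(distrC (midpoint _ _)) ?midpoint_distr; lra.
Qed.

(** The circulations of the four children add up to that of [T], and perimeters
are halved, so one child keeps the quadratic lower bound. *)
Lemma circulation_child (B : set V) T (e : R) :
  (forall x y, B x -> B y -> B (midpoint x y)) ->
  (forall x y, B x -> B y -> I y x = - I x y) ->
  (forall x y, B x -> B y -> I x y = I x (midpoint x y) + I (midpoint x y) y) ->
  vertices_in B T -> e * perimeter T ^+ 2 < `|circulation T| ->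
  exists T', child T T' /\ e * perimeter T' ^+ 2 < `|circulation T'|.
Proof.
move=> Bmid Irev Isplit [Ba Bb Bc] lt_circ; apply: contrapT => nT'.
have le_circ T' : child T T' ->
    `|circulation T'| <= 4^-1 * (e * perimeter T ^+ 2).
  move=> TT'; rewrite leNgt; apply/negP => H; apply: nT'; exists T'.
  split => //; apply: le_lt_trans H; rewrite (child_perimeter TT').
  by rewrite le_eqVlt; apply/orP; left; apply/eqP; field.
have := le_circ _ (Or41 _ _ _ erefl); have := le_circ _ (Or42 _ _ _ erefl).
have := le_circ _ (Or43 _ _ _ erefl); have := le_circ _ (Or44 _ _ _ erefl).
move: Ba Bb Bc lt_circ {nT' le_circ}; case: T => -[a b] c /= Ba Bb Bc.
set P := perimeter _; rewrite /circulation /=.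
rewrite (Isplit a b) // (Isplit b c) // (Isplit c a) //.
have Bp := Bmid _ _ Ba Bb; have Bq := Bmid _ _ Bb Bc; have Br := Bmid _ _ Bc Ba.
rewrite (Irev (midpoint a b) (midpoint c a)) //.
rewrite (Irev (midpoint b c) (midpoint a b)) //.
rewrite (Irev (midpoint c a) (midpoint b c)) //.
move: (e * _) => E.
rewrite ltNge => /negP H H4 H3 H2 H1; apply: H.
rewrite !ler_norml in H1 H2 H3 H4 *.
move: H1 H2 H3 H4 => /andP[? ?] /andP[? ?] /andP[? ?] /andP[? ?].
by apply/andP; split; lra.
Qed.

End Triangles.

Lemma lim_dist_le (R : realType) (V : normedModType R) (u : nat -> V) (y z : V)
    (C : R) (k : nat) : u @ \oo --> z ->
  (forall m, `|u (k + m)%N - y| <= C) -> `|z - y| <= C.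
Proof.
move=> uz uC; apply/ler_addgt0Pl => e e0.
have [m _ /(_ (k + m)%N)] : \forall m \near \oo, `|z - u m| < e.
  by move/cvgrPdist_lt : uz; apply.
rewrite /= leq_addl => /(_ isT) zum.
have := ler_normD (z - u (k + m)%N) (u (k + m)%N - y); rewrite addrA subrK.
have := uC m; lra.
Qed.

Section Goursat.
Variables (R : realType) (n : nat).
Local Notation V := 'rV[R]_n.
Variables (w : V -> V -> R) (c0 : V) (r : R).
Local Notation B := (ball c0 r).
Hypothesis w_lin : forall x, lin (w x).
Hypothesis w_cont : forall x, B x -> forall v, {for x, continuous (w ^~ v)}.
Hypothesis w_der : forall z, B z ->
  exists2 D, form_derivative w z D & forall u v, D u v = D v u.
Local Notation I := (line_integral w).

(** The derivative at [z] is symmetric, so the main terms of the three sides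
cancel. *)
Lemma circulation_small z (e : R) : B z -> 0 < e ->
  \forall M \near (0 : R)^'+, forall T : triangle V, vertices_in B T ->
    vertices_in [set x | `|x - z| <= M] T ->
    `|circulation I T| <= e * M * perimeter T.
Proof.
move=> Bz e0; have [D [Db wD] Dsym] := w_der Bz.
have wDe := wD e e0; near=> M => -[[a b] c] [/= Ba Bb Bc] [/= aM bM cM].
have wDM : form_approx w D z e [set x | `|x - z| <= M] by near: M.
have side x y : B x -> B y -> `|x - z| <= M -> `|y - z| <= M ->
  `|I x y - (w z (y - z) + 2^-1 * D (y - z) (y - z)
           - (w z (x - z) + 2^-1 * D (x - z) (x - z)))| <= e * M * `|y - x|.
  move=> Bx By xM yM.
  have [phi [phiP _]] := line_integral_primitive w_lin w_cont Bx By.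
  have -> : I x y = phi 1 - phi 0 by exact: (line_integralE w_cont).
  have zp (p : V) : z + (p - z) = p by rewrite addrC subrK.
  have := @segment_estimate_antisym _ _ w D z e M (x - z) (y - z) phi
    (ltW e0) (w_lin z) Db wDM xM yM.
  rewrite !zp opprB addrA subrK => /(_ phiP).
  by rewrite (Dsym (x - z)) subrr mulr0 addr0.
have := side a b Ba Bb aM bM; have := side b c Bb Bc bM cM.
have := side c a Bc Ba cM aM.
rewrite /circulation /perimeter /= !mulrDr !ler_norml.
move=> /andP[? ?] /andP[? ?] /andP[? ?]; apply/andP; split; lra.
Unshelve. all: by end_near. Qed.

(** Bisection, keeping the lower bound [e * perimeter ^+ 2] on the circulation,
produces triangles that shrink to a point [z]; there [circulation_small]
contradicts the bound. *)
Lemma goursat_circulation T : vertices_in B T -> circulation I T = 0.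
Proof.
move=> BT; apply: contrapT => /eqP; rewrite -normr_gt0 => circ0.
(* The term + 1 keeps the denominator positive for a degenerate triangle. *)
pose e := `|circulation I T| / (2 * (perimeter T ^+ 2 + 1)).
have P0 : 0 <= perimeter T ^+ 2 by rewrite sqr_ge0.
have e0 : 0 < e by rewrite divr_gt0 // mulr_gt0 //; lra.
have eT : e * perimeter T ^+ 2 < `|circulation I T|.
  rewrite /e mulrAC ltr_pdivrMr; last by lra.
  by rewrite ltr_pM2l //; lra.
have [rho rhor KT] : exists2 rho, rho < r &
    vertices_in [set x | `|x - c0| <= rho] T.
  case: T BT {circ0 e P0 e0 eT} => -[a b] c [/=].
  rewrite -ball_normE /= !(distrC c0) => ar br cr.
  exists (Num.max `|a - c0| (Num.max `|b - c0| `|c - c0|)).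
    by rewrite !gt_max ar br cr.
  by split; rewrite /= !le_max lexx ?orbT.
pose K := [set x | `|x - c0| <= rho].
have KB x : K x -> B x.
  by rewrite /K -ball_normE /= distrC => xr; exact: le_lt_trans rhor.
have Kmid x y : K x -> K y -> K (midpoint x y).
  by apply: norm_segment_le; exact: in01_half.
have KBT T' : vertices_in K T' -> vertices_in B T'.
  by case=> *; split; exact: KB.
have step (T' : triangle V) : exists T'', vertices_in K T' /\
    e * perimeter T' ^+ 2 < `|circulation I T'| -> child T' T'' /\
    e * perimeter T'' ^+ 2 < `|circulation I T''|.
  have [H|H] := pselect (vertices_in K T' /\
    e * perimeter T' ^+ 2 < `|circulation I T'|); last by exists T'.
  have [KT' eT'] := H.
  have [] := @circulation_child R _ I K T' e Kmid _ _ KT' eT'.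
  - by move=> x y /KB Bx /KB By; exact: (line_integral_rev w_lin w_cont).
  - by move=> x y /KB Bx /KB By; exact: (line_integral_split w_lin w_cont).
  - by move=> T'' ?; exists T''.
have [next nextP] := choice step.
pose S k := iter k next T.
have SK k : vertices_in K (S k) /\
    e * perimeter (S k) ^+ 2 < `|circulation I (S k)|.
  elim: k => [//|k IH]; have [ch ?] := nextP _ IH; split => //.
  exact: child_vertices ch IH.1.
have Sch k : child (S k) (S k.+1) by have [] := nextP _ (SK k).
have perS k : perimeter (S k) = 2^-1 ^+ k * perimeter T.
  elim: k => [|k IH]; first by rewrite mul1r.
  by rewrite (child_perimeter (Sch k)) IH exprS mulrA.
have drift k m :
    `|(S (k + m)%N).1.1 - (S k).1.1|
    <= perimeter (S k) - perimeter (S (k + m)%N).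
  elim: m => [|m IH]; first by rewrite addn0 !subrr normr0.
  rewrite addnS; have := child_drift (Sch (k + m)%N).
  have := ler_normD ((S (k + m).+1).1.1 - (S (k + m)%N).1.1)
                    ((S (k + m)%N).1.1 - (S k).1.1).
  rewrite addrA subrK; lra.
have perS_ge0 k : 0 <= perimeter (S k) by rewrite !addr_ge0.
have driftS k m : `|(S (k + m)%N).1.1 - (S k).1.1| <= perimeter (S k).
  by rewrite (le_trans (drift k m)) // gerBl.
have small d : 0 < d -> exists k, perimeter (S k) < d.
  move=> d0; have : geometric (perimeter T) (2^-1 : R) @ \oo --> 0.
    by apply: cvg_geometric; rewrite ger0_norm //; lra.
  move=> /cvgrPdist_lt/(_ d d0)[k _ /(_ k (leqnn k))].
  rewrite /geometric /= sub0r normrN mulrC -perS ger0_norm // => ?.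
  by exists k.
have /cvg_ex[z Sz] : cvg ((fun k => (S k).1.1) @ \oo).
  suff : cauchy_ex ((fun k => (S k).1.1) @ \oo) by move/cauchy_exP/cauchy_cvg.
  move=> d d0; have [k kd] := small d d0.
  exists (S k).1.1; exists k => // m /= km; rewrite -ball_normE /= distrC.
  by rewrite -(subnKC km); exact: le_lt_trans (driftS k _) kd.
have Bz : B z.
  apply: KB; apply: (lim_dist_le (k := 0) Sz) => m.
  by have [[]] := SK m.
have e4 : 0 < e / 2 by rewrite divr_gt0.
have [d /= d0 small_circ] := circulation_small Bz e4.
have d2 : 0 < d / 2 by rewrite divr_gt0.
have [k kd] := small (d / 2) d2.
have [SkK] := SK k; apply/negP; rewrite -leNgt.
have zk : `|z - (S k).1.1| <= perimeter (S k).
  by apply: (lim_dist_le (k := k) Sz) => m; exact: driftS.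
(* M = 2 * perimeter does, unless the triangle is a point: then any small M. *)
have [M [M0 Md PM MP]] : exists M, [/\ 0 < M, M < d, 2 * perimeter (S k) <= M &
    M * perimeter (S k) <= 2 * perimeter (S k) ^+ 2].
  have [P0'|Pn0] := eqVneq (perimeter (S k)) 0.
    by exists (d / 2); rewrite P0' !mulr0 expr0n /= mulr0; split => //; lra.
  have Pgt0 : 0 < perimeter (S k) by rewrite lt_neqAle eq_sym Pn0 perS_ge0.
  by exists (2 * perimeter (S k)); split; [lra|lra|lra|rewrite expr2 mulrA].
have vM : vertices_in [set x | `|x - z| <= M] (S k).
  have H : `|(S k).1.1 - z| <= perimeter (S k) by rewrite distrC.
  move: H PM; rewrite /perimeter; case: (S k) => -[a b] c /= H PM.
  have A := normr_ge0 (b - a); have B' := normr_ge0 (c - b).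
  have C := normr_ge0 (a - c).
  split => /=; first by lra.
  - by have := ler_normD (b - a) (a - z); rewrite addrA subrK; lra.
  - by have := ler_normD (c - a) (a - z); rewrite addrA subrK (distrC c a); lra.
have dM : `|0 - M| < d by rewrite sub0r normrN gtr0_norm.
rewrite (le_trans (small_circ M dM M0 (S k) (KBT _ SkK) vM)) //.
by rewrite -mulrA; nra.
Unshelve. all: by end_near. Qed.

Theorem line_integral_additive a b c : B a -> B b -> B c ->
  I a b + I b c = I a c.
Proof.
move=> Ba Bb Bc; have := @goursat_circulation (a, b, c).
rewrite /circulation /= (line_integral_rev w_lin w_cont Ba Bc).
by move=> H; apply/eqP; rewrite -subr_eq0; apply/eqP/H.
Qed.

End Goursat.

(** * Forms given by their components *)

Lemma normr_coord_le (R : realType) n (v : 'rV[R]_n) k : `|v 0 k| <= `|v|.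
Proof.
rewrite [leRHS]/Num.norm /= mx_normrE.
exact: (le_bigmax _ (fun i : 'I_1 * 'I_n => `|v i.1 i.2|) (0, k)).
Qed.

Section DifferentiableEstimate.
Variables (R : realType) (V : normedModType R) (f : V -> R) (x : V).

Lemma differentiable_estimate (e : R) : differentiable f x -> 0 < e ->
  \forall y \near x, `|f y - f x - 'd f x (y - x)| <= e * `|y - x|.
Proof.
move=> /diff_locally/eqaddoP/(_ e) df e0.
have := df e0; rewrite (near_shift 0 x) /=; apply: filterS => y /=.
rewrite subr0 -[(_ - _) y]/(f (y + x) - (f x + 'd f x y)) => H.
by rewrite addrK -addrA -opprD.
Qed.

(** The converse of [differentiable_estimate], with the directional derivatives
as a by-product. *)
Lemma estimate_differentiable (L : V -> R) : lin L -> continuous L ->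
  (forall e : R, 0 < e ->
    \forall y \near x, `|f y - f x - L (y - x)| <= e * `|y - x|) ->
  differentiable f x /\ forall v, 'D_v f x = L v.
Proof.
move=> Llin Lc fL.
pose Lm : {linear V -> R} := HB.pack L (GRing.isLinear.Build _ _ _ _ L Llin).
have E : f \o shift x = cst (f x) + Lm +o_ 0 id.
  apply/eqaddoP => e e0; have := fL e e0.
  rewrite (near_shift 0 x) /=; apply: filterS => y /=.
  rewrite subr0 addrK -[(_ - _) y]/(f (y + x) - (f x + L y)).
  by rewrite -addrA -opprD.
have dE := diff_unique (df := Lm) Lc E.
have df : differentiable f x.
  by apply/diff_locallyP; rewrite dE; split.
by split=> // v; rewrite deriveE // dE.
Qed.

End DifferentiableEstimate.

Lemma is_derive_segment (R : realType) (V : normedModType R) (f : V -> R)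
    (a b : V) (t : R) : differentiable f (segment a b t) ->
  is_derive t 1 (f \o segment a b) ('d f (segment a b t) (b - a)).
Proof.
move=> df; have ds : is_diff t (segment a b) ( *:%R^~ (b - a)).
  have -> : segment a b = cst a + *:%R^~ (b - a) by [].
  by apply: is_diff_eq; rewrite add0r.
have dfs : differentiable (f \o segment a b) t by exact: differentiable_comp.
apply: DeriveDef; first exact/derivable1_diffP.
by rewrite deriveE // diff_comp //= diff_val scale1r.
Qed.

Lemma near_right_closed_ball (R : realType) (V : normedModType R) (z : V)
    (P : V -> Prop) : (\forall x \near z, P x) ->
  \forall M \near (0 : R)^'+, forall x, `|x - z| <= M -> P x.
Proof.
move=> /nbhs_normP[d /= d0 dP]; near=> M => x xM; apply: dP.
by rewrite /= distrC (le_lt_trans xM) //; near: M; exact: nbhs_right_lt.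
Unshelve. all: by end_near. Qed.

Lemma cvg_sumr (R : realType) (T : Type) (F : set_system T) (n : nat)
    (g : 'I_n -> T -> R) (l : 'I_n -> R) : Filter F ->
  (forall k, g k x @[x --> F] --> l k) ->
  \sum_k g k x @[x --> F] --> \sum_k l k.
Proof.
move=> FF gl; rewrite -fct_sumE; elim/big_rec2: _ => [|k h m _ hm].
  exact: cvg_cst.
exact: cvgD.
Qed.

Section CoordinateForms.
Variables (R : realType) (n : nat).
Local Notation V := 'rV[R]_n.
Implicit Types (G : 'I_n -> V -> R) (x z u v : V).
Local Notation basis k := (delta_mx 0 k : V).

Definition coord_form G x v : R := \sum_k v 0 k * G k x.

Lemma coord_form_lin G x : lin (coord_form G x).
Proof.
move=> a u v; rewrite /coord_form mulr_sumr -big_split /=.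
by apply: eq_bigr => k _; rewrite !mxE mulrDl mulrA.
Qed.

Lemma coord_sum_bound (c : 'I_n -> R) v (e : R) : 0 <= e ->
  (forall k, `|c k| <= e) -> `|\sum_k v 0 k * c k| <= n%:R * e * `|v|.
Proof.
move=> e0 ce; apply: (le_trans (ler_norm_sum _ _ _)).
rewrite -mulrA mulr_natl -[X in _ *+ X]card_ord -sumr_const.
apply: ler_sum => k _; rewrite normrM mulrC.
by apply: ler_pM => //; exact: normr_coord_le.
Qed.

Lemma diff_coord (f : V -> R) z u : differentiable f z ->
  'd f z u = \sum_k u 0 k * 'D_(basis k) f z.
Proof.
move=> df; rewrite [in LHS](row_sum_delta u) linear_sum.
by apply: eq_bigr => k _; rewrite linearZ deriveE.
Qed.

Definition coord_form_derivative G z u v : R := \sum_k v 0 k * 'd (G k) z u.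

Lemma coord_form_has_derivative G z : (forall k, differentiable (G k) z) ->
  form_derivative (coord_form G) z (coord_form_derivative G z).
Proof.
move=> dG; split.
  split=> u; last first.
    move=> a v v'; rewrite /coord_form_derivative mulr_sumr -big_split /=.
    apply: eq_bigr => k _; rewrite linearP /= mulrDr.
    by rewrite /GRing.scale /=; ring.
  move=> a v v'; rewrite /coord_form_derivative mulr_sumr -big_split /=.
  by apply: eq_bigr => k _; rewrite !mxE mulrDl mulrA.
move=> e e0; pose e' := e / n.+1%:R; have e'0 : 0 < e' by rewrite divr_gt0.
have near_z : \forall x \near z, forall k,
    `|G k x - G k z - 'd (G k) z (x - z)| <= e' * `|x - z|.
  apply: (@filter_forall _ _ _ (nbhs z)) => k.
  exact (differentiable_estimate (dG k) e'0).
apply: filterS (near_right_closed_ball near_z) => M HM x /= xM v.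
have -> : coord_form G x v - coord_form G z v
      - coord_form_derivative G z (x - z) v =
    \sum_k v 0 k * (G k x - G k z - 'd (G k) z (x - z)).
  rewrite /coord_form /coord_form_derivative -!sumrB; apply: eq_bigr => k _.
  by rewrite !mulrBr.
apply: (le_trans (coord_sum_bound _ _ (HM x xM))).
  by rewrite mulr_ge0 // ltW.
rewrite mulrA ler_wpM2r // ler_wpM2r // /e' mulrCA ler_piMr ?ltW //.
by rewrite ltr_pdivrMr // mul1r ltr_nat.
Qed.

Lemma coord_form_derivative_symmetric G z :
  (forall k, differentiable (G k) z) ->
  (forall j k, 'D_(basis j) (G k) z = 'D_(basis k) (G j) z) ->
  forall u v, coord_form_derivative G z u v = coord_form_derivative G z v u.
Proof.
move=> dG sG u v; rewrite /coord_form_derivative.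
under eq_bigr do rewrite diff_coord // mulr_sumr.
under [RHS]eq_bigr do rewrite diff_coord // mulr_sumr.
rewrite exchange_big /=; apply: eq_bigr => j _; apply: eq_bigr => k _.
by rewrite sG; ring.
Qed.

Lemma coord_form_derivative_basis G z j k : differentiable (G k) z ->
  coord_form_derivative G z (basis j) (basis k) = 'D_(basis j) (G k) z.
Proof.
move=> dG; rewrite /coord_form_derivative (bigD1 k) //= big1 => [|i ik].
  by rewrite addr0 mxE !eqxx mul1r deriveE.
by rewrite mxE (negbTE ik) andbF mul0r.
Qed.

(** Since the second derivatives may be discontinuous, symmetry is obtained from
the integrals of the gradient along small triangles with a vertex at [z]. *)
Lemma partial_derivatives_commute (f : V -> R) z j k :
  (\forall x \near z, differentiable f x) ->
  (forall i, differentiable ('D_(basis i) f) z) ->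
  'D_(basis j) ('D_(basis k) f) z = 'D_(basis k) ('D_(basis j) f) z.
Proof.
move=> df ddf; pose G i := 'D_(basis i) f.
transitivity (coord_form_derivative G z (basis j) (basis k)).
  by rewrite coord_form_derivative_basis //; exact: ddf.
transitivity (coord_form_derivative G z (basis k) (basis j)); last first.
  by rewrite coord_form_derivative_basis //; exact: ddf.
apply: (@form_derivative_symmetric _ _ (coord_form G) _ z f).
- exact: coord_form_lin.
- exact: coord_form_has_derivative.
apply: filterS (near_right_closed_ball df) => M HM a b az bz t t01.
have := is_derive_segment (HM _ (norm_segment_le t01 az bz)).
by rewrite diff_coord //; exact/HM/norm_segment_le.
Qed.

End CoordinateForms.

(** * The Poincare lemma *)

Section Poincare.
Variables (R : realType) (Omega : set 'rV[R]_3).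
Local Notation basis k := (delta_mx 0 k : 'rV[R]_3).

(** The components [G k] are differentiable but possibly with discontinuous
derivatives, so that the usual differentiation under the integral sign is not
available. Goursat's theorem makes the line integral of the form additive on
balls, and simple connectedness makes it a difference of values of [Psi]. *)
Theorem poincare (G : 'I_3 -> 'rV[R]_3 -> R) : open Omega ->
  simply_connected Omega ->
  (forall x, Omega x -> forall k, differentiable (G k) x) ->
  (forall x, Omega x ->
     forall j k, 'D_(basis j) (G k) x = 'D_(basis k) (G j) x) ->
  exists Psi, forall x, Omega x ->
    differentiable Psi x /\ forall k, 'D_(basis k) Psi x = G k x.
Proof.
move=> Oo Osc dG sG; pose w := coord_form G.
have wl : forall x, lin (w x) by exact: coord_form_lin.
have wc c r : ball c r `<=` Omega ->
    forall x, ball c r x -> forall v, {for x, continuous (w ^~ v)}.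
  move=> s x /s Ox v; rewrite /w /coord_form.
  apply: (@cvg_sumr _ _ (nbhs _)) => k; apply: cvgM; first exact: cvg_cst.
  exact/differentiable_continuous/dG.
have [Psi PsiP] : exists Psi : 'rV[R]_3 -> R,
    forall x y, share_ball Omega x y -> Psi y - Psi x = line_integral w x y.
  apply: cocycle_trivial => // c r s x y z.
  apply: line_integral_additive => //; first exact: wc.
  move=> p /s Op; exists (coord_form_derivative G p).
    exact/coord_form_has_derivative/dG.
  by apply: coord_form_derivative_symmetric; [exact: dG|exact: sG].
exists Psi => x Ox.
suff [dPsi DPsi] : differentiable Psi x /\ forall v, 'D_v Psi x = w x v.
  split => // k; rewrite DPsi /w /coord_form (bigD1 k) //= big1 => [|i ik].
    by rewrite addr0 mxE !eqxx mul1r.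
  by rewrite mxE (negbTE ik) andbF mul0r.
apply: estimate_differentiable => //.
  move=> v; apply: (@cvg_sumr _ _ (nbhs _)) => k.
  apply: cvgM; last exact: cvg_cst.
  exact: coord_continuous.
move=> e e0; pose e' := e / 3; have e'0 : 0 < e' by rewrite divr_gt0.
have /nbhs_ballP[r r0 xr] := open_nbhs_nbhs (conj Oo Ox).
have near_G : \forall y \near x, forall k, `|G k y - G k x| <= e'.
  apply: (@filter_forall _ _ _ (nbhs x)) => k.
  have /cvgrPdist_le/(_ e' e'0) := differentiable_continuous (dG x Ox k).
  by apply: filterS => y; rewrite distrC.
have /nbhs_ballP[d d0 dG'] := near_G.
near=> y.
have yr : ball x r y by near: y; exact: nbhsx_ballx.
have yd : ball x d y by near: y; exact: nbhsx_ballx.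
rewrite PsiP; last by exists x, r; split => //; exact: ballxx.
(* Near x the increment of Psi is an integral along a segment; subtracting the
   integral of the constant form w x leaves a form that is small there. *)
have wcr := wc x r xr.
have [phi [phiP _]] := line_integral_primitive wl wcr (ballxx x r0) yr.
rewrite (line_integralE wcr (ballxx x r0) yr phiP).
pose psi t := phi t - t * w x (y - x).
have psiP : primitive01 (fun t => form_on w x y t - w x (y - x)) psi.
  move=> t t01; have phit := phiP t t01; rewrite /psi.
  by apply: is_derive_eq; rewrite /GRing.scale /=; ring.
have -> : phi 1 - phi 0 - w x (y - x) = psi 1 - psi 0 by rewrite /psi; ring.
apply: primitive01_bound psiP _ => t t01.
have sd := ball_segment01 (ballxx x d0) yd t01.
have -> : form_on w x y t - w x (y - x) =
    \sum_k (y - x) 0 k * (G k (segment x y t) - G k x).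
  rewrite /form_on /w /coord_form -sumrB.
  by apply: eq_bigr => k _; rewrite mulrBr.
apply: (le_trans (coord_sum_bound _ (ltW e'0) (dG' _ sd))).
have -> : 3%:R * e' = e by rewrite /e' mulrC divfK // pnatr_eq0.
exact: lexx.
Unshelve. all: by end_near. Qed.

End Poincare.

(** * Complex-valued functions *)

Lemma near_eq_differentiable (R : realType) (V : normedModType R) (f g : V -> R)
    (x : V) : (\forall y \near x, f y = g y) ->
  differentiable f x -> differentiable g x.
Proof.
move=> fg df; have fgx := nbhs_singleton fg.
have dlin : lin ('d f x) by move=> a u v; rewrite linearP.
suff [] : differentiable g x /\ forall v, 'D_v g x = 'd f x v by [].
apply: estimate_differentiable => //; first exact: diff_continuous.
move=> e e0.
have := differentiable_estimate df e0; apply: filterS2 fg => y <-.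
by rewrite -fgx.
Qed.

Section RealProduct.
Variables (R : realType) (V : normedModType R) (f g : V -> R) (x v : V).
Hypotheses (df : differentiable f x) (dg : differentiable g x).

Lemma deriveM_fun :
  'D_v (fun y => f y * g y) x = 'D_v f x * g x + f x * 'D_v g x.
Proof.
rewrite -[fun y => _]/(f * g) deriveM; try exact: diff_derivable.
by rewrite /GRing.scale /= addrC mulrC.
Qed.

Lemma differentiableM_fun : differentiable (fun y => f y * g y) x.
Proof. exact: differentiableM. Qed.

End RealProduct.

Section ComplexCalculus.
Variable R : realType.
Local Notation C := R[i].
Local Notation point := 'rV[R]_3.
Implicit Types (f g : point -> C) (x : point) (k : 'I_3).

Lemma ReD (a b : C) : complex.Re (a + b) = complex.Re a + complex.Re b.
Proof. by case: a b => [? ?] []. Qed.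
Lemma ImD (a b : C) : complex.Im (a + b) = complex.Im a + complex.Im b.
Proof. by case: a b => [? ?] []. Qed.
Lemma ReN (a : C) : complex.Re (- a) = - complex.Re a.
Proof. by case: a. Qed.
Lemma ImN (a : C) : complex.Im (- a) = - complex.Im a.
Proof. by case: a. Qed.
Lemma ReM (a b : C) : complex.Re (a * b) =
  complex.Re a * complex.Re b - complex.Im a * complex.Im b.
Proof. by case: a b => [? ?] []. Qed.
Lemma ImM (a b : C) : complex.Im (a * b) =
  complex.Re a * complex.Im b + complex.Im a * complex.Re b.
Proof. by case: a b => [? ?] []. Qed.
Lemma ReV (a : C) : complex.Re a^-1 =
  complex.Re a / (complex.Re a ^+ 2 + complex.Im a ^+ 2).
Proof. by case: a. Qed.
Lemma ImV (a : C) : complex.Im a^-1 =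
  - (complex.Im a / (complex.Re a ^+ 2 + complex.Im a ^+ 2)).
Proof. by case: a. Qed.

Lemma complex_ext (a b : C) : complex.Re a = complex.Re b ->
  complex.Im a = complex.Im b -> a = b.
Proof. by case: a b => [? ?] [? ?] /= -> ->. Qed.

Lemma near_eq_cdifferentiable f g x : (\forall y \near x, f y = g y) ->
  cdifferentiable f x -> cdifferentiable g x.
Proof.
by move=> fg [dr di]; split; [move: dr|move: di]; apply: near_eq_differentiable;
  apply: filterS fg => y ->.
Qed.

Lemma near_eq_partial k f g x : (\forall y \near x, f y = g y) ->
  partial k f x = partial k g x.
Proof.
by move=> fg; rewrite /partial; congr (_ +i* _); apply: near_eq_derive;
  apply: filterS fg => y ->.
Qed.

Lemma cdifferentiableD f g x : cdifferentiable f x -> cdifferentiable g x ->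
  cdifferentiable (fun y => f y + g y) x.
Proof.
move=> [fr fi] [gr gi]; split.
- under eq_fun do rewrite ReD; exact: differentiableD.
- under eq_fun do rewrite ImD; exact: differentiableD.
Qed.

Lemma cdifferentiableN f x : cdifferentiable f x ->
  cdifferentiable (fun y => - f y) x.
Proof.
move=> [fr fi]; split.
- under eq_fun do rewrite ReN; exact: differentiableN.
- under eq_fun do rewrite ImN; exact: differentiableN.
Qed.

Lemma cdifferentiableM f g x : cdifferentiable f x -> cdifferentiable g x ->
  cdifferentiable (fun y => f y * g y) x.
Proof.
move=> [fr fi] [gr gi]; split.
- under eq_fun do rewrite ReM.
  by apply: differentiableB; exact: differentiableM_fun.
- under eq_fun do rewrite ImM.
  by apply: differentiableD; exact: differentiableM_fun.
Qed.

Lemma cdifferentiableV f x : f x != 0 -> cdifferentiable f x ->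
  cdifferentiable (fun y => (f y)^-1) x.
Proof.
move=> fx0 [fr fi].
pose m y := complex.Re (f y) * complex.Re (f y) +
            complex.Im (f y) * complex.Im (f y).
have dm : differentiable m x.
  by apply: differentiableD; exact: differentiableM_fun.
have m0 : m x != 0.
  apply: contra fx0; rewrite /m paddr_eq0 -?expr2 ?sqr_ge0 // !expf_eq0 /=.
  by rewrite eq_complex.
have dmV : differentiable (fun y => (m y)^-1) x by exact: differentiableV.
split.
- under eq_fun do rewrite ReV -!/(_ ^+ 2) !expr2 -/(m _).
  exact: differentiableM_fun.
- under eq_fun do rewrite ImV !expr2 -/(m _).
  by apply: differentiableN; exact: differentiableM_fun.
Qed.

Lemma partialD k f g x : cdifferentiable f x -> cdifferentiable g x ->
  partial k (fun y => f y + g y) x = partial k f x + partial k g x.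
Proof.
move=> [fr fi] [gr gi]; rewrite /partial.
under eq_fun do rewrite ReD; under [in X in _ +i* X]eq_fun do rewrite ImD.
by congr (_ +i* _); rewrite -deriveD; try exact: diff_derivable.
Qed.

Lemma partialN k f x : cdifferentiable f x ->
  partial k (fun y => - f y) x = - partial k f x.
Proof.
move=> [fr fi]; rewrite /partial.
under eq_fun do rewrite ReN; under [in X in _ +i* X]eq_fun do rewrite ImN.
by congr (_ +i* _); rewrite -deriveN; try exact: diff_derivable.
Qed.

Lemma partialM k f g x : cdifferentiable f x -> cdifferentiable g x ->
  partial k (fun y => f y * g y) x = partial k f x * g x + f x * partial k g x.
Proof.
move=> [fr fi] [gr gi]; rewrite /partial.
under eq_fun do rewrite ReM; under [in X in _ +i* X]eq_fun do rewrite ImM.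
apply: complex_ext; rewrite ?ReD ?ImD ?ReM ?ImM /=.
- rewrite deriveB; try by apply/diff_derivable/differentiableM_fun.
  by rewrite !deriveM_fun //; ring.
- rewrite deriveD; try by apply/diff_derivable/differentiableM_fun.
  by rewrite !deriveM_fun //; ring.
Qed.

Lemma cdifferentiable_continuous_neq0 f x : cdifferentiable f x -> f x != 0 ->
  \forall y \near x, f y != 0.
Proof.
move=> [fr fi] fx0.
have cfr := differentiable_continuous fr.
have cfi := differentiable_continuous fi.
move: fx0; rewrite eq_complex negb_and => /orP[] h.
- near=> y; rewrite eq_complex negb_and; apply/orP; left; near: y.
  exact: (cfr _ (open_nbhs_nbhs (conj (@open_neq _ 0) h))).
- near=> y; rewrite eq_complex negb_and; apply/orP; right; near: y.
  exact: (cfi _ (open_nbhs_nbhs (conj (@open_neq _ 0) h))).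
Unshelve. all: by end_near. Qed.

(** Differentiate [f * f^-1 = 1]. *)
Lemma partialV k f x : f x != 0 -> cdifferentiable f x ->
  partial k (fun y => (f y)^-1) x = - (partial k f x / f x ^+ 2).
Proof.
move=> fx0 df; have dV := cdifferentiableV fx0 df.
have : partial k (fun y => f y * (f y)^-1) x = 0.
  rewrite -(partial_cst k 1 x); apply: near_eq_partial.
  apply: filterS (cdifferentiable_continuous_neq0 df fx0) => y fy.
  by rewrite divff.
rewrite partialM // => H.
apply: (mulfI fx0); apply/eqP; rewrite -subr_eq0 -[X in _ == X]H; apply/eqP.
by field.
Qed.

End ComplexCalculus.

(** * Scalar and vector parts of biquaternions *)

Section VectorParts.
Variable R : realType.
Local Notation C := R[i].
Local Notation point := 'rV[R]_3.

(** The three vector components, indexed like the partial derivatives. *)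
Definition vcoord (q : biquat R) (k : 'I_3) : C := bq_coord q (lift ord0 k).

Lemma vcoordE (q : biquat R) : [/\ vcoord q 0 = bq_coord q 1,
  vcoord q 1 = bq_coord q 2%:R & vcoord q 2%:R = bq_coord q 3%:R].
Proof. by split; congr bq_coord; exact: val_inj. Qed.

Lemma bq_ext_vcoord (p q : biquat R) : bq_coord p 0 = bq_coord q 0 ->
  (forall k, vcoord p k = vcoord q k) -> p = q.
Proof.
move=> e0 e; have [p1 p2 p3] := vcoordE p; have [q1 q2 q3] := vcoordE q.
by apply: bq_ext; rewrite // -?p1 -?p2 -?p3 -?q1 -?q2 -?q3.
Qed.

Lemma vcoordZ a q k : vcoord (a *: q) k = a * vcoord q k.
Proof. exact: bq_coordZ. Qed.

Lemma vcoordD p q k : vcoord (p + q) k = vcoord p k + vcoord q k.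
Proof. exact: bq_coordD. Qed.

Lemma ord3P (P : 'I_3 -> Prop) : P 0 -> P 1 -> P 2%:R -> forall k, P k.
Proof.
move=> P0 P1 P2 k; have : k \in [:: 0; 1; 2%:R] by case: k => -[|[|[|//]]] ?.
by rewrite !inE => /or3P[] /eqP ->.
Qed.

Lemma sum3 (F : 'I_3 -> C) : \sum_k F k = F 0 + F 1 + F 2%:R.
Proof.
rewrite !big_ord_recr big_ord0 /= add0r; congr (F _ + F _ + F _);
  exact: val_inj.
Qed.

Lemma imaginary_units_comb (a b c : C) :
  a *: bi R + b *: bj R + c *: bk R = mk_biquat 0 a b c.
Proof.
apply: bq_ext; rewrite !bq_coordD !bq_coordZ /bi /bj /bk.
- by rewrite !bq_coord_mk0 !mulr0 !addr0.
- by rewrite !bq_coord_mk1 !mulr0 !addr0 mulr1.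
- by rewrite !bq_coord_mk2 !mulr0 addr0 add0r mulr1.
- by rewrite !bq_coord_mk3 !mulr0 !add0r mulr1.
Qed.

Lemma gradE (f : point -> C) x :
  grad f x = mk_biquat 0 (partial 0 f x) (partial 1 f x) (partial 2%:R f x).
Proof. exact: imaginary_units_comb. Qed.

Lemma vcoord_grad (f : point -> C) x k : vcoord (grad f x) k = partial k f x.
Proof.
have [e0 e1 e2] := vcoordE (grad f x); move: k; apply: ord3P.
- by rewrite e0 gradE bq_coord_mk1.
- by rewrite e1 gradE bq_coord_mk2.
- by rewrite e2 gradE bq_coord_mk3.
Qed.

Lemma purely_vectorial_grad (f : point -> C) x : bq_coord (grad f x) 0 = 0.
Proof. by rewrite gradE bq_coord_mk0. Qed.

Lemma vcoord_log_deriv (f : point -> C) x k :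
  vcoord (log_deriv f x) k = (f x)^-1 * partial k f x.
Proof. by rewrite /log_deriv Dop_scal vcoordZ vcoord_grad. Qed.

Lemma purely_vectorial_log_deriv (f : point -> C) x :
  bq_coord (log_deriv f x) 0 = 0.
Proof.
by rewrite /log_deriv Dop_scal bq_coordZ purely_vectorial_grad mulr0.
Qed.

Definition bq_simp := (mul0r, mul1r, sub0r, subr0, add0r, addr0,
  oppr0).

Lemma bq_mul_il (q : biquat R) : bi R * q = mk_biquat (- bq_coord q 1)
  (bq_coord q 0) (- bq_coord q 3%:R) (bq_coord q 2%:R).
Proof.
rewrite [LHS]/(bq_mul _ _) /bq_mul /bi !bq_coordE; congr mk_biquat;
  by rewrite !bq_simp.
Qed.

Lemma bq_mul_jl (q : biquat R) : bj R * q = mk_biquat (- bq_coord q 2%:R)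
  (bq_coord q 3%:R) (bq_coord q 0) (- bq_coord q 1).
Proof.
rewrite [LHS]/(bq_mul _ _) /bq_mul /bj !bq_coordE; congr mk_biquat;
  by rewrite !bq_simp.
Qed.

Lemma bq_mul_kl (q : biquat R) : bk R * q = mk_biquat (- bq_coord q 3%:R)
  (- bq_coord q 2%:R) (bq_coord q 1) (bq_coord q 0).
Proof.
rewrite [LHS]/(bq_mul _ _) /bq_mul /bk !bq_coordE; congr mk_biquat;
  by rewrite !bq_simp.
Qed.

Lemma bq_mul_vectorial (p q : biquat R) :
  bq_coord p 0 = 0 -> bq_coord q 0 = 0 ->
  p * q = mk_biquat
    (- (vcoord p 0 * vcoord q 0 + vcoord p 1 * vcoord q 1
        + vcoord p 2%:R * vcoord q 2%:R))
    (vcoord p 1 * vcoord q 2%:R - vcoord p 2%:R * vcoord q 1)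
    (vcoord p 2%:R * vcoord q 0 - vcoord p 0 * vcoord q 2%:R)
    (vcoord p 0 * vcoord q 1 - vcoord p 1 * vcoord q 0).
Proof.
move=> p0 q0; have [-> -> ->] := vcoordE p; have [-> -> ->] := vcoordE q.
rewrite [LHS]/(bq_mul _ _) /bq_mul p0 q0; congr mk_biquat;
  rewrite !(mul0r, mulr0, sub0r, subr0, add0r, addr0) //.
- by rewrite !opprD.
- by rewrite addrC.
Qed.

(** When [p j] is the [j]-th partial derivative of [F] and [q = F x], [r = h x],
the left side is the first-order operator: its scalar part is a divergence and
its vector part a curl, both corrected by [h]. *)
Lemma bq_curl_div (p : 'I_3 -> biquat R) (q r : biquat R) :
  (forall j, bq_coord (p j) 0 = 0) -> bq_coord q 0 = 0 -> bq_coord r 0 = 0 ->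
  let c j k := vcoord (p j) k + vcoord q j * vcoord r k in
  bi R * p 0 + bj R * p 1 + bk R * p 2%:R + q * r =
  mk_biquat (- (c 0 0 + c 1 1 + c 2%:R 2%:R)) (c 1 2%:R - c 2%:R 1)
    (c 2%:R 0 - c 0 2%:R) (c 0 1 - c 1 0).
Proof.
move=> p0 q0 r0 c.
rewrite bq_mul_il bq_mul_jl bq_mul_kl (bq_mul_vectorial q0 r0) !p0.
rewrite /c; have [-> -> ->] := vcoordE (p 0); have [-> -> ->] := vcoordE (p 1).
have [-> -> ->] := vcoordE (p 2%:R).
apply: bq_ext; rewrite !bq_coordD.
- by rewrite !bq_coord_mk0; ring.
- by rewrite !bq_coord_mk1; ring.
- by rewrite !bq_coord_mk2; ring.
- by rewrite !bq_coord_mk3; ring.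
Qed.

Lemma mk_biquat_eq0 (a b c d : C) :
  mk_biquat a b c d = 0 <-> [/\ a = 0, b = 0, c = 0 & d = 0].
Proof.
have zero k : bq_coord (0 : biquat R) k = 0 by rewrite /bq_coord mxE.
split=> [E|[-> -> -> ->]].
  by split; [rewrite -(bq_coord_mk0 a b c d)|rewrite -(bq_coord_mk1 a b c d)|
    rewrite -(bq_coord_mk2 a b c d)|rewrite -(bq_coord_mk3 a b c d)];
    rewrite E zero.
by apply: bq_ext; rewrite zero ?bq_coord_mk0 ?bq_coord_mk1 ?bq_coord_mk2
  ?bq_coord_mk3.
Qed.

Lemma curl_div_eq0 (c : 'I_3 -> 'I_3 -> C) :
  mk_biquat (- (c 0 0 + c 1 1 + c 2%:R 2%:R)) (c 1 2%:R - c 2%:R 1)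
    (c 2%:R 0 - c 0 2%:R) (c 0 1 - c 1 0) = 0 <->
  \sum_k c k k = 0 /\ forall j k, c j k = c k j.
Proof.
rewrite mk_biquat_eq0 sum3; split=> [[div e1 e2 e3]|[div curl]].
  split; first by apply/eqP; rewrite -oppr_eq0; apply/eqP.
  move/eqP: e1; rewrite subr_eq0 => /eqP e1.
  move/eqP: e2; rewrite subr_eq0 => /eqP e2.
  move/eqP: e3; rewrite subr_eq0 => /eqP e3.
  by apply: ord3P; apply: ord3P.
by split; [rewrite div oppr0|rewrite curl subrr|rewrite curl subrr|
  rewrite curl subrr].
Qed.

Lemma vcoord_bq_partial j (F : point -> biquat R) x k :
  vcoord (bq_partial j F x) k = partial j (fun y => vcoord (F y) k) x.
Proof. by rewrite /vcoord /bq_coord mxE. Qed.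

(** The equation div F + F . h = 0 is the vanishing of the trace of the matrix
[c], and curl F + F x h = 0 is its symmetry; the latter form is the one that
enters the integrability condition. *)
Lemma first_order_coords (h F : point -> biquat R) x :
  (\forall y \near x, bq_coord (F y) 0 = 0) -> bq_coord (h x) 0 = 0 ->
  let c j k := partial j (fun y => vcoord (F y) k) x
               + vcoord (F x) j * vcoord (h x) k in
  Dop F x + Mr h F x = 0 <->
  \sum_k c k k = 0 /\ forall j k, c j k = c k j.
Proof.
move=> F0 h0 c.
have P0 j : bq_coord (bq_partial j F x) 0 = 0.
  by rewrite /bq_coord mxE -(partial_cst j 0 x); exact: near_eq_partial.
have Fx0 : bq_coord (F x) 0 = 0 := nbhs_singleton F0.
have cE : c = fun j k => vcoord (bq_partial j F x) k
                         + vcoord (F x) j * vcoord (h x) k.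
  by apply/funext => j; apply/funext => k; rewrite vcoord_bq_partial.
rewrite -curl_div_eq0 cE /Dop /Mr.
by rewrite (bq_curl_div (p := fun j => bq_partial j F x) P0 Fx0 h0).
Qed.

End VectorParts.

(** * The first-order equation and the Schroedinger equation *)

Section Factorization.
Variable R : realType.
Local Notation C := R[i].
Local Notation point := 'rV[R]_3.
Implicit Types (A : set point) (f Psi : point -> C) (F q : point -> biquat R).

Lemma partial_commute f x j k : (\forall y \near x, cdifferentiable f y) ->
  (forall i, cdifferentiable (partial i f) x) ->
  partial j (partial k f) x = partial k (partial j f) x.
Proof.
move=> df ddf; apply: complex_ext => /=.
- apply: (@partial_derivatives_commute _ _ (fun y => complex.Re (f y)) x j k).
    by apply: filterS df => y [].
  by move=> i; have [] := ddf i.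
- apply: (@partial_derivatives_commute _ _ (fun y => complex.Im (f y)) x j k).
    by apply: filterS df => y [].
  by move=> i; have [] := ddf i.
Qed.

Lemma near_open A x (P : point -> Prop) : open A -> A x ->
  (forall y, A y -> P y) -> \forall y \near x, P y.
Proof. by move=> Ao Ax AP; exact: filterS AP (open_nbhs_nbhs (conj Ao Ax)). Qed.

Lemma open_nonzero A f : open A -> (forall x, A x -> cdifferentiable f x) ->
  open (A `&` [set x | f x != 0]).
Proof.
move=> Ao df; rewrite openE => x [Ax fx0].
apply: filterI; first exact: open_nbhs_nbhs.
exact: cdifferentiable_continuous_neq0 (df x Ax) fx0.
Qed.

Lemma near_eq_log_deriv f g x : (\forall y \near x, f y = g y) ->
  log_deriv f x = log_deriv g x.
Proof.
move=> fg; apply: bq_ext_vcoord => [|k].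
  apply: eq_trans (purely_vectorial_log_deriv f x) _.
  exact/esym/purely_vectorial_log_deriv.
apply: eq_trans (vcoord_log_deriv f x k) _.
apply: eq_trans _ (esym (vcoord_log_deriv g x k)).
congr (_^-1 * _); first exact: nbhs_singleton fg.
exact: near_eq_partial.
Qed.

Lemma eq_log_antiderivative A B f g q : open A -> B `<=` A ->
  (forall x, A x -> f x = g x) ->
  log_antiderivative B f q -> log_antiderivative B g q.
Proof.
move=> Ao BA fg fq x Bx; have [df f0 lf] := fq x Bx.
have near_fg := near_open Ao (BA x Bx) fg.
split; first exact: near_eq_cdifferentiable near_fg df.
  by rewrite -(nbhs_singleton near_fg).
by rewrite -lf; apply/esym/near_eq_log_deriv.
Qed.

Lemma log_antiderivative_partial A f q x k : log_antiderivative A f q -> A x ->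
  partial k f x = f x * vcoord (q x) k.
Proof.
move=> fq /fq[_ fx0 <-].
by rewrite vcoord_log_deriv mulrA divff // mul1r.
Qed.

(** The factor on the right depends on [q] only, so two logarithmic
antiderivatives of the same [q] solve the same Schroedinger equations. *)
Lemma log_antiderivative_laplacian A f q : open A -> log_antiderivative A f q ->
  (forall x, A x -> forall k, cdifferentiable (fun y => vcoord (q y) k) x) ->
  twice_differentiable_on A f /\
  forall x, A x -> laplacian f x = f x *
    \sum_k (vcoord (q x) k ^+ 2 + partial k (fun y => vcoord (q y) k) x).
Proof.
move=> Ao fq dq.
have near_partial x k : A x ->
    \forall y \near x, f y * vcoord (q y) k = partial k f y.
  move=> Ax; apply: (near_open Ao Ax) => y Ay.
  by rewrite (log_antiderivative_partial k fq Ay).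
split=> [x Ax|x Ax].
  have [df _ _] := fq x Ax; split=> // k.
  apply: near_eq_cdifferentiable (near_partial x k Ax) _.
  exact: cdifferentiableM (dq x Ax k).
have [df _ _] := fq x Ax.
rewrite /laplacian mulr_sumr; apply: eq_bigr => k _.
rewrite -(near_eq_partial k (near_partial x k Ax)) partialM //; last exact: dq.
rewrite (log_antiderivative_partial k fq Ax).
move: (vcoord _ _) (partial _ _ _) => a b; ring.
Qed.

Variables (Omega : set point) (u f0 : point -> C).
Hypotheses (Omega_open : open Omega) (f0_sol : schrodinger_sol Omega u f0)
  (f0_neq0 : forall x, Omega x -> f0 x != 0).
Local Notation h := (log_deriv f0).

Let f0_diff x : Omega x -> cdifferentiable f0 x.
Proof. by move=> /f0_sol.1[]. Qed.

Let f0_diff2 x k : Omega x -> cdifferentiable (partial k f0) x.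
Proof. by move=> /f0_sol.1[]. Qed.

Lemma first_order_solP F : first_order_sol Omega h F <->
  forall x, Omega x -> [/\ bq_coord (F x) 0 = 0,
    forall k, cdifferentiable (fun y => vcoord (F y) k) x,
    \sum_k (partial k (fun y => vcoord (F y) k) x
            + vcoord (F x) k * vcoord (h x) k) = 0 &
    forall j k, partial j (fun y => vcoord (F y) k) x
                  + vcoord (F x) j * vcoord (h x) k =
                partial k (fun y => vcoord (F y) j) x
                  + vcoord (F x) k * vcoord (h x) j].
Proof.
have h0 x := purely_vectorial_log_deriv f0 x.
split=> FP x Ox.
  have F0 : \forall y \near x, bq_coord (F y) 0 = 0.
    by apply: (near_open Omega_open Ox) => y /FP[].
  have [dF Fx0 /(first_order_coords F0 (h0 x))[div curl]] := FP x Ox.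
  by split => // k; exact: dF.
have F0 : \forall y \near x, bq_coord (F y) 0 = 0.
  by apply: (near_open Omega_open Ox) => y /FP[].
have [Fx0 dF div curl] := FP x Ox; split=> //; last first.
  exact/(first_order_coords F0 (h0 x)).
move=> k; have [l ->|->] := unliftP ord0 k; first exact: dF.
apply: (@near_eq_cdifferentiable _ (cst 0)).
  by apply: filterS F0 => y ->.
by split; exact: differentiable_cst.
Qed.

Lemma grad_potentialP F Psi : (forall x, Omega x -> bq_coord (F x) 0 = 0) ->
  grad_potential Omega f0 F Psi <->
  forall x, Omega x -> cdifferentiable Psi x /\
    forall k, partial k Psi x = (f0 x)^-1 * vcoord (F x) k.
Proof.
move=> F0; split=> PsiP x Ox; have [dPsi PsiE] := PsiP x Ox; split=> //.
  by move=> k; rewrite -vcoordZ -PsiE vcoord_grad.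
apply: bq_ext_vcoord => [|k]; last by rewrite vcoord_grad PsiE vcoordZ.
by rewrite purely_vectorial_grad bq_coordZ F0 // mulr0.
Qed.

(** The symmetry of [c j k] in [first_order_coords] is the symmetry of the
Jacobian of [F / f0], because the derivative of [f0^-1] produces the term
[- h j * F k]. *)
Lemma potential_exists F : simply_connected Omega ->
  first_order_sol Omega h F -> exists Psi, grad_potential Omega f0 F Psi.
Proof.
move=> Osc /first_order_solP FP.
pose G k y := (f0 y)^-1 * vcoord (F y) k.
have dV x : Omega x -> cdifferentiable (fun y => (f0 y)^-1) x.
  by move=> Ox; apply: cdifferentiableV (f0_neq0 Ox) (f0_diff Ox).
have dG x k : Omega x -> cdifferentiable (G k) x.
  move=> Ox; have [_ dF _ _] := FP x Ox.
  exact: cdifferentiableM (dV x Ox) (dF k).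
have sG x j k : Omega x -> partial j (G k) x = partial k (G j) x.
  move=> Ox; have [_ dF _ curl] := FP x Ox.
  have GE i l : partial i (G l) x = (f0 x)^-1 *
      (partial i (fun y => vcoord (F y) l) x - vcoord (F x) l * vcoord (h x) i).
    rewrite (partialM i (dV x Ox) (dF l)).
    rewrite (partialV i (f0_neq0 Ox) (f0_diff Ox)) vcoord_log_deriv.
    move: (partial _ _ _) (partial _ _ _) (vcoord _ _) (f0_neq0 Ox) => a b c.
    by move: (f0 x) => d d0; field.
  rewrite !GE; congr (_ * _).
  move: (curl j k); move: (partial _ _ _) (partial _ _ _) (_ * _) (_ * _).
  by move=> a b c d /eqP; rewrite -subr_eq => /eqP <-; ring.
have [PsiR PsiRP] := @poincare _ _ (fun k y => complex.Re (G k y))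
  Omega_open Osc
  (fun x Ox k => (dG x k Ox).1)
  (fun x Ox j k => congr1 (@complex.Re R) (sG x j k Ox)).
have [PsiI PsiIP] := @poincare _ _ (fun k y => complex.Im (G k y))
  Omega_open Osc
  (fun x Ox k => (dG x k Ox).2)
  (fun x Ox j k => congr1 (@complex.Im R) (sG x j k Ox)).
exists (fun y => PsiR y +i* PsiI y); apply/grad_potentialP => [x /FP[] //|x Ox].
have [dR DR] := PsiRP x Ox; have [dI DI] := PsiIP x Ox.
split; first by split.
by move=> k; apply: complex_ext => /=; [exact: DR|exact: DI].
Qed.

Definition sum_log_deriv Psi x := h x + log_deriv Psi x.

Definition nonzero_domain Psi := Omega `&` [set x | Psi x != 0].

Lemma purely_vectorial_sum_log_deriv Psi x :
  bq_coord (sum_log_deriv Psi x) 0 = 0.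
Proof.
have add0 (p q : biquat R) :
    bq_coord p 0 = 0 -> bq_coord q 0 = 0 -> bq_coord (p + q) 0 = 0.
  by move=> p0 q0; rewrite bq_coordD p0 q0 addr0.
by apply: add0; exact: purely_vectorial_log_deriv.
Qed.

Lemma vcoord_sum_log_deriv Psi x k : vcoord (sum_log_deriv Psi x) k =
  (f0 x)^-1 * partial k f0 x + (Psi x)^-1 * partial k Psi x.
Proof.
by rewrite -(vcoord_log_deriv f0) -(vcoord_log_deriv Psi); exact: vcoordD.
Qed.

Section Product.
Variables (F : point -> biquat R) (Psi : point -> C).
Hypotheses (F_sol : first_order_sol Omega h F)
  (Psi_pot : grad_potential Omega f0 F Psi).

Let FP := (first_order_solP F).1 F_sol.

Let PsiP : forall x, Omega x -> cdifferentiable Psi x /\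
  forall k, partial k Psi x = (f0 x)^-1 * vcoord (F x) k.
Proof. by apply/grad_potentialP => // x /FP[]. Qed.

Let Psi_diff x (Ox : Omega x) : cdifferentiable Psi x := (PsiP Ox).1.

Lemma partial_product x k : Omega x -> partial k (fun y => f0 y * Psi y) x =
  partial k f0 x * Psi x + vcoord (F x) k.
Proof.
move=> Ox; have [dPsi PsiE] := PsiP Ox.
by rewrite (partialM k (f0_diff Ox) dPsi) PsiE mulVKf // f0_neq0.
Qed.

(** The gradient of [f0 * Psi] is [Psi grad f0 + F]; taking the divergence, the
terms besides [Psi Delta f0] form the scalar part of the first-order
equation. *)
Lemma product_solution : schrodinger_sol Omega u (fun y => f0 y * Psi y).
Proof.
have near_partial x k : Omega x -> \forall y \near x,
    partial k f0 y * Psi y + vcoord (F y) k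
    = partial k (fun y => f0 y * Psi y) y.
  move=> Ox; apply: (near_open Omega_open Ox) => y Oy.
  by rewrite partial_product.
have df0Psi x k : Omega x ->
    cdifferentiable (fun y => partial k f0 y * Psi y) x.
  by move=> Ox; exact: cdifferentiableM (f0_diff2 k Ox) (Psi_diff Ox).
split=> x Ox; have [_ dF div _] := FP Ox.
  split=> [|k]; first exact: cdifferentiableM (f0_diff Ox) (Psi_diff Ox).
  apply: near_eq_cdifferentiable (near_partial x k Ox) _.
  exact: cdifferentiableD (df0Psi x k Ox) (dF k).
have lapE : laplacian (fun y => f0 y * Psi y) x = laplacian f0 x * Psi x.
  rewrite -[RHS]addr0 -div /laplacian mulr_suml -big_split /=.
  apply: eq_bigr => k _; rewrite -(near_eq_partial k (near_partial x k Ox)).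
  rewrite (partialD k (df0Psi x k Ox) (dF k)).
  rewrite (partialM k (f0_diff2 k Ox) (Psi_diff Ox)) (PsiP Ox).2.
  rewrite vcoord_log_deriv.
  move: (partial _ _ _) (partial _ _ _) (partial _ _ _) (vcoord _ _) => a b c d.
  by move: (Psi x) => p; ring.
rewrite lapE mulrA -mulNr -mulrDl (_ : _ + _ = 0) ?mul0r //.
exact: f0_sol.2.
Qed.

Lemma nonzero_domain_open : open (nonzero_domain Psi).
Proof. exact: open_nonzero Omega_open Psi_diff. Qed.

Lemma product_log_antiderivative : log_antiderivative (nonzero_domain Psi)
  (fun y => f0 y * Psi y) (sum_log_deriv Psi).
Proof.
move=> x [Ox /= Psi0]; have [dPsi PsiE] := PsiP Ox; split.
- exact: cdifferentiableM (f0_diff Ox) dPsi.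
- by rewrite mulf_neq0 // f0_neq0.
apply: bq_ext_vcoord => [|k].
  by rewrite purely_vectorial_log_deriv purely_vectorial_sum_log_deriv.
rewrite vcoord_sum_log_deriv vcoord_log_deriv (partialM k (f0_diff Ox) dPsi).
move: (partial _ _ _) (partial _ _ _) Psi0 (f0_neq0 Ox) => a b.
by move: (Psi x) (f0 x) => c d c0 d0; field; rewrite c0 d0.
Qed.

Lemma sum_log_deriv_diff x k : nonzero_domain Psi x ->
  cdifferentiable (fun y => vcoord (sum_log_deriv Psi y) k) x.
Proof.
move=> nx; have [Ox /= Psi0] := nx; have [_ dF _ _] := FP Ox.
have dV := cdifferentiableV (f0_neq0 Ox) (f0_diff Ox).
have : \forall y \near x,
    (f0 y)^-1 * partial k f0 y + (Psi y)^-1 * ((f0 y)^-1 * vcoord (F y) k)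
    = vcoord (sum_log_deriv Psi y) k.
  apply: (near_open Omega_open Ox) => y Oy.
  by rewrite vcoord_sum_log_deriv (PsiP Oy).2.
move=> /near_eq_cdifferentiable; apply.
apply: cdifferentiableD; first exact: cdifferentiableM dV (f0_diff2 k Ox).
apply: cdifferentiableM (cdifferentiableV Psi0 (Psi_diff Ox)) _.
exact: cdifferentiableM dV (dF k).
Qed.

(** The value of the factor in [log_antiderivative_laplacian] is known to be [u]
from the solution [f0 * Psi]. *)
Lemma log_antiderivative_solution f :
  log_antiderivative (nonzero_domain Psi) f (sum_log_deriv Psi) ->
  schrodinger_sol (nonzero_domain Psi) u f.
Proof.
move=> fq; have no := nonzero_domain_open.
have dq x (nx : nonzero_domain Psi x) k := sum_log_deriv_diff k nx.
have [tf lf] := log_antiderivative_laplacian no fq dq.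
have [_ lp] := log_antiderivative_laplacian no product_log_antiderivative dq.
split=> // x nx; have [Ox Psi0] := nx; rewrite lf //.
have := product_solution.2 x Ox; rewrite lp //.
move: (\sum_k _) => S; have : f0 x * Psi x != 0 by rewrite mulf_neq0 // f0_neq0.
move: (f0 x * Psi x) => p p0 /eqP; rewrite -mulrN mulrC -mulrDl mulf_eq0.
rewrite (negbTE p0) orbF addrC subr_eq0 => /eqP ->; ring.
Qed.

End Product.

(** Here [F = f0 grad Psi = grad f - Psi grad f0], and the matrix [c] of
[first_order_coords] is [Hess f - Psi Hess f0]: its symmetry is that of second
derivatives, and its trace vanishes because [f] and [f0] solve the same
equation. *)
Lemma solution_first_order f : schrodinger_sol Omega u f ->
  exists F, first_order_sol Omega h F /\
            grad_potential Omega f0 F (fun x => (f0 x)^-1 * f x).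
Proof.
move=> [f_diff f_eq].
pose Psi y := (f0 y)^-1 * f y.
pose Fk k y := partial k f y - Psi y * partial k f0 y.
pose F y := mk_biquat 0 (Fk 0 y) (Fk 1 y) (Fk 2%:R y).
have FE y k : vcoord (F y) k = Fk k y.
  have [e0 e1 e2] := vcoordE (F y); move: k; apply: ord3P.
  - by rewrite e0 bq_coord_mk1.
  - by rewrite e1 bq_coord_mk2.
  - by rewrite e2 bq_coord_mk3.
have F0 y : bq_coord (F y) 0 = 0 by exact: bq_coord_mk0.
have df x : Omega x -> cdifferentiable f x by move=> /f_diff[].
have df2 x k : Omega x -> cdifferentiable (partial k f) x by move=> /f_diff[].
have dV x : Omega x -> cdifferentiable (fun y => (f0 y)^-1) x.
  by move=> Ox; apply: cdifferentiableV (f0_neq0 Ox) (f0_diff Ox).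
have dPsi x : Omega x -> cdifferentiable Psi x.
  by move=> Ox; exact: cdifferentiableM (dV x Ox) (df x Ox).
have PsiE x k : Omega x -> partial k Psi x = (f0 x)^-1 * Fk k x.
  move=> Ox; rewrite (partialM k (dV x Ox) (df x Ox)).
  rewrite (partialV k (f0_neq0 Ox) (f0_diff Ox)) /Fk /Psi.
  move: (partial _ _ _) (partial _ _ _) (f0_neq0 Ox) => a b.
  by move: (f x) (f0 x) => c d d0; field.
have dP x k : Omega x -> cdifferentiable (fun y => Psi y * partial k f0 y) x.
  by move=> Ox; exact: cdifferentiableM (dPsi x Ox) (f0_diff2 k Ox).
have dFk x k : Omega x -> cdifferentiable (Fk k) x.
  move=> Ox; apply: cdifferentiableD (df2 x k Ox) _.
  exact: cdifferentiableN (dP x k Ox).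
have FEf k : (fun y => vcoord (F y) k) = Fk k by apply/funext => y; exact: FE.
have dFE x j k : Omega x -> partial j (Fk k) x = partial j (partial k f) x
    - (partial j Psi x * partial k f0 x + Psi x * partial j (partial k f0) x).
  move=> Ox; rewrite (partialD j (df2 x k Ox) (cdifferentiableN (dP x k Ox))).
  by rewrite (partialN j (dP x k Ox)) (partialM j (dPsi x Ox) (f0_diff2 k Ox)).
have cE x j k : Omega x ->
    partial j (fun y => vcoord (F y) k) x + vcoord (F x) j * vcoord (h x) k =
    partial j (partial k f) x - Psi x * partial j (partial k f0) x.
  move=> Ox; rewrite FEf FE vcoord_log_deriv dFE // PsiE //.
  move: (partial _ _ _) (partial _ _ _) (partial _ _ _) (Fk _ _) => a b c d.
  by move: (Psi x) (f0 x)^-1 => p v; ring.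
exists F; split; last first.
  apply/grad_potentialP => // x Ox; split; first exact: dPsi.
  by move=> k; rewrite FE; exact: PsiE.
apply/first_order_solP => x Ox; split=> //.
- by move=> k; rewrite FEf; exact: dFk.
- transitivity (laplacian f x - Psi x * laplacian f0 x).
    rewrite /laplacian mulr_sumr -sumrB.
    by apply: eq_bigr => k _; exact: cE.
  have := f_eq x Ox; have := f0_sol.2 x Ox.
  move: (laplacian _ _) (laplacian _ _) => a b /eqP.
  rewrite addrC subr_eq0 => /eqP <- /eqP; rewrite addrC subr_eq0 => /eqP <-.
  rewrite /Psi; move: (f x) (f0 x) (f0_neq0 Ox) (u x) => c d d0 v.
  by field.
- move=> j k; apply: (eq_trans (cE x j k Ox)).
  apply: (eq_trans _ (esym (cE x k j Ox))).
  have sub_congr (a b c d : C) : a = b -> c = d ->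
    a - Psi x * c = b - Psi x * d by move=> -> ->.
  apply: sub_congr; apply: partial_commute.
  + exact: (near_open Omega_open Ox).
  + by move=> i; exact: df2.
  + exact: (near_open Omega_open Ox).
  + by move=> i; exact: f0_diff2.
Qed.

End Factorization.

Theorem theorem7 (R : realType) (Omega : set 'rV[R]_3)
    (u f0 : 'rV[R]_3 -> R[i])
    (Omega_open : open Omega)
    (f0_sol : schrodinger_sol Omega u f0)
    (f0_neq0 : forall x, Omega x -> f0 x != 0) :
  let h := log_deriv f0 in
  let q (Psi : 'rV[R]_3 -> R[i]) := fun x => h x + log_deriv Psi x in
  let nz (Psi : 'rV[R]_3 -> R[i]) := Omega `&` [set x | Psi x != 0] in
  [/\ (* grad Psi = F / f0 is solvable *)
      simply_connected Omega ->
        forall F, first_order_sol Omega h F ->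
        exists Psi, grad_potential Omega f0 F Psi,
      (* the logarithmic antiderivatives of q exist and are solutions *)
      forall F Psi, first_order_sol Omega h F ->
        grad_potential Omega f0 F Psi ->
        (exists f, [/\ schrodinger_sol Omega u f,
                       forall x, Omega x -> (f x == 0) = (Psi x == 0) &
                       log_antiderivative (nz Psi) f (q Psi)]) /\
        (forall f, log_antiderivative (nz Psi) f (q Psi) ->
           schrodinger_sol (nz Psi) u f) &
      (* every solution is a logarithmic antiderivative of such a q *)
      forall f, schrodinger_sol Omega u f ->
        exists F Psi, [/\ first_order_sol Omega h F,
                          grad_potential Omega f0 F Psi,
                          forall x, Omega x -> (f x == 0) = (Psi x == 0) &
                          log_antiderivative (nz Psi) f (q Psi)]].
Proof.
move=> h q nz; split.
- by move=> Osc F; exact: (potential_exists Omega_open f0_sol f0_neq0).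
- move=> F Psi F_sol Psi_pot; split.
    exists (fun y => f0 y * Psi y); split.
    + exact: (product_solution Omega_open f0_sol f0_neq0 F_sol Psi_pot).
    + by move=> x Ox; rewrite mulf_eq0 (negbTE (f0_neq0 x Ox)).
    + exact: (product_log_antiderivative Omega_open f0_sol f0_neq0 F_sol
        Psi_pot).
  move=> f.
  exact: (log_antiderivative_solution Omega_open f0_sol f0_neq0 F_sol Psi_pot).
move=> f f_sol; have [F [F_sol Psi_pot]] := solution_first_order
  Omega_open f0_sol f0_neq0 f_sol.
pose Psi y := (f0 y)^-1 * f y.
exists F, Psi; split=> //.
  by move=> x Ox; rewrite mulf_eq0 invr_eq0 (negbTE (f0_neq0 x Ox)).
have f0Psi x : Omega x -> f0 x * Psi x = f x.
  by move=> Ox; rewrite /Psi mulVKf // f0_neq0.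
apply: (eq_log_antiderivative Omega_open _ f0Psi); first by move=> x [].
exact: (product_log_antiderivative Omega_open f0_sol f0_neq0 F_sol Psi_pot).
Qed.
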